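(* Let $1<p<q$ and let $Y$ be a reflexive asymptotically $q$-uniformly smooth Banach space. (i) If a Banach space $X$ contains a sequence which is asymptotically $\ell_1$, then $\alpha_Y(X)\le 1/q$. (ii) If $X$ is an infinite dimensional Banach space with the $p$-co-Banach-Saks property and not containing $\ell_1$, then $\alpha_Y(X)\le p/q$. In either case, $X$ does not coarse Lipschitz embed into $Y$.
   Context: A sequence $(x_n)$ in $X$ is asymptotically $\ell_1$ if there is $L>0$ such that for every $m$ there is $k$ such that for all $k\le n_1<\dots<n_m$, $(x_{n_j})_{j=1}^m$ is $L$-equivalent to the first $m$ unit vectors of $\ell_1$. $X$ has the $p$-co-Banach-Saks property if every semi-normalized weakly null sequence $(x_n)$ has a subsequence $(x_{n_j})$ and $c>0$ with $\|x_{n_{j_1}}+\dots+x_{n_{j_k}}\|\ge ck^{1/p}$ for all $k\le j_1<\dots<j_k$. $Y$ is asymptotically $q$-uniformly smooth if $\overline\rho_Y(t)\le Ct^q$ on $[0,1]$ for some $C$, where $\overline{\rho}_Y(t)=\sup_{x\in\partial B_Y}\inf_{\dim(Y/E)<\infty}\sup_{h\in\partial B_E}\|x+th\|-1$. For $f:X\to Y$, $\omega_f(t)=\sup\{\|f(x)-f(y)\|:\|x-y\|\le t\}$, $\rho_f(t)=\inf\{\|f(x)-f(y)\|:\|x-y\|\ge t\}$; coarse embedding: $\omega_f<\infty$ and $\rho_f(t)\to\infty$; coarse Lipschitz embedding: $\omega_f(t)\le Lt+L$, $\rho_f(t)\ge L^{-1}t-L$ for some $L$. The compression exponent $\alpha_Y(X)$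 is the supremum of $\alpha>0$ for which there exist a coarse embedding $f:X\to Y$ and $L>0$ with $\|f(x)-f(y)\|\ge L^{-1}\|x-y\|^\alpha-L$ for all $x,y$ ($0$ if none). *)

(* Defs.v *)
From Stdlib Require Import Reals Lra.
Open Scope R_scope.

Record Banach := {
  car :> Type;
  vzero : car;
  vadd : car -> car -> car;
  vopp : car -> car;
  vscal : R -> car -> car;
  vnorm : car -> R;
  vadd_assoc : forall x y z, vadd x (vadd y z) = vadd (vadd x y) z;
  vadd_comm : forall x y, vadd x y = vadd y x;
  vadd_0 : forall x, vadd x vzero = x;
  vadd_opp : forall x, vadd x (vopp x) = vzero;
  vscal_1 : forall x, vscal 1 x = x;
  vscal_assoc : forall a b x, vscal a (vscal b x) = vscal (a * b) x;
  vscal_distr_v : forall a x y, vscal a (vadd x y) = vadd (vscal a x) (vscal a y);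
  vscal_distr_s : forall a b x, vscal (a + b) x = vadd (vscal a x) (vscal b x);
  vnorm_eq0 : forall x, vnorm x = 0 -> x = vzero;
  vnorm_scal : forall a x, vnorm (vscal a x) = Rabs a * vnorm x;
  vnorm_triangle : forall x y, vnorm (vadd x y) <= vnorm x + vnorm y;
  vcomplete : forall u : nat -> car,
    (forall eps, 0 < eps -> exists N, forall m n, (N <= m)%nat -> (N <= n)%nat ->
        vnorm (vadd (u m) (vopp (u n))) < eps) ->
    exists l, forall eps, 0 < eps -> exists N, forall n, (N <= n)%nat ->
        vnorm (vadd (u n) (vopp l)) < eps
}.

Arguments vzero {_}.
Arguments vadd {_}.
Arguments vopp {_}.
Arguments vscal {_}.
Arguments vnorm {_}.

Definition vsub {X : Banach} (x y : X) : X := vadd x (vopp y).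

Fixpoint vsum {X : Banach} (f : nat -> X) (m : nat) : X :=
  match m with O => vzero | S m' => vadd (vsum f m') (f m') end.
Fixpoint rsum (f : nat -> R) (m : nat) : R :=
  match m with O => 0 | S m' => rsum f m' + f m' end.

(** real power t^a for t >= 0 (with 0^a = 0, a > 0) *)
Definition rpow (t a : R) : R := if Rle_dec t 0 then 0 else Rpower t a.

Definition is_dual {X : Banach} (f : X -> R) : Prop :=
  (forall x y, f (vadd x y) = f x + f y) /\
  (forall a x, f (vscal a x) = a * f x) /\
  (exists M, forall x, Rabs (f x) <= M * vnorm x).

Definition is_bidual {X : Banach} (Phi : (X -> R) -> R) : Prop :=
  (forall f g, is_dual f -> is_dual g -> Phi (fun x => f x + g x) = Phi f + Phi g) /\
  (forall a f, is_dual f -> Phi (fun x => a * f x) = a * Phi f) /\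
  (exists M, forall f K, is_dual f -> (forall x, Rabs (f x) <= K * vnorm x) ->
      Rabs (Phi f) <= M * K).

Definition reflexive (X : Banach) : Prop :=
  forall Phi : (X -> R) -> R, is_bidual Phi ->
    exists x : X, forall f, is_dual f -> Phi f = f x.

Definition closed_subspace {X : Banach} (E : X -> Prop) : Prop :=
  E vzero /\ (forall x y, E x -> E y -> E (vadd x y)) /\
  (forall a x, E x -> E (vscal a x)) /\
  (forall (u : nat -> X) l, (forall n, E (u n)) ->
     (forall eps, 0 < eps -> exists N, forall n, (N <= n)%nat -> vnorm (vsub (u n) l) < eps) ->
     E l).

Definition finite_codim {X : Banach} (E : X -> Prop) : Prop :=
  closed_subspace E /\
  exists (k : nat) (ys : nat -> X), forall y : X,
    exists (cs : nat -> R) (e : X), E e /\ y = vadd (vsum (fun i => vscal (cs i) (ys i)) k) e.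

(** [rho_bar_le Y t b] : \overline\rho_Y(t) <= b, i.e. the sup-inf-sup unfolded *)
Definition rho_bar_le (Y : Banach) (t b : R) : Prop :=
  forall x : Y, vnorm x = 1 -> forall eps, 0 < eps ->
    exists E : Y -> Prop, finite_codim E /\
      forall h : Y, E h -> vnorm h = 1 -> vnorm (vadd x (vscal t h)) - 1 <= b + eps.

Definition asymptotically_q_uniformly_smooth (q : R) (Y : Banach) : Prop :=
  exists C, forall t, 0 <= t <= 1 -> rho_bar_le Y t (C * rpow t q).

Definition incr_upto (n : nat -> nat) (m : nat) : Prop :=
  forall i, (S i < m)%nat -> (n i < n (S i))%nat.

Definition asymptotically_l1 {X : Banach} (x : nat -> X) : Prop :=
  exists L, 0 < L /\ forall m : nat, exists k : nat, forall n : nat -> nat,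
    incr_upto n m -> (k <= n 0%nat)%nat ->
    forall a : nat -> R,
      / L * rsum (fun j => Rabs (a j)) m <= vnorm (vsum (fun j => vscal (a j) (x (n j))) m) /\
      vnorm (vsum (fun j => vscal (a j) (x (n j))) m) <= L * rsum (fun j => Rabs (a j)) m.

Definition contains_asymptotically_l1 (X : Banach) : Prop :=
  exists x : nat -> X, asymptotically_l1 x.

Definition semi_normalized {X : Banach} (x : nat -> X) : Prop :=
  exists a b, 0 < a /\ forall n, a <= vnorm (x n) <= b.

Definition weakly_null {X : Banach} (x : nat -> X) : Prop :=
  forall f : X -> R, is_dual f -> Un_cv (fun n => f (x n)) 0.

Definition strictly_incr (phi : nat -> nat) : Prop := forall i, (phi i < phi (S i))%nat.

Definition co_banach_saks (p : R) (X : Banach) : Prop :=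
  forall x : nat -> X, semi_normalized x -> weakly_null x ->
    exists phi : nat -> nat, strictly_incr phi /\ exists c, 0 < c /\
      forall (k : nat) (j : nat -> nat), incr_upto j k -> (k <= j 0%nat)%nat ->
        vnorm (vsum (fun i => x (phi (j i))) k) >= c * rpow (INR k) (/ p).

Definition infinite_dimensional (X : Banach) : Prop :=
  ~ exists (k : nat) (xs : nat -> X), forall x : X,
      exists cs : nat -> R, x = vsum (fun i => vscal (cs i) (xs i)) k.

Definition in_l1 (f : nat -> R) : Prop := exists l, infinite_sum (fun n => Rabs (f n)) l.

Definition contains_l1 (X : Banach) : Prop :=
  exists (T : (nat -> R) -> X) (a b : R), 0 < a /\
    (forall f g, in_l1 f -> in_l1 g -> T (fun n => f n + g n) = vadd (T f) (T g)) /\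
    (forall c f, in_l1 f -> T (fun n => c * f n) = vscal c (T f)) /\
    (forall f l, infinite_sum (fun n => Rabs (f n)) l -> a * l <= vnorm (T f) <= b * l).

Definition coarse_embedding {X Y : Banach} (f : X -> Y) : Prop :=
  (forall t, exists M, forall x y, vnorm (vsub x y) <= t -> vnorm (vsub (f x) (f y)) <= M) /\
  (forall K, exists T, forall t, t >= T ->
     forall x y, vnorm (vsub x y) >= t -> vnorm (vsub (f x) (f y)) >= K).

Definition coarse_lipschitz_embeds (X Y : Banach) : Prop :=
  exists (f : X -> Y) (L : R), 0 < L /\
    (forall t x y, vnorm (vsub x y) <= t -> vnorm (vsub (f x) (f y)) <= L * t + L) /\
    (forall t x y, vnorm (vsub x y) >= t -> vnorm (vsub (f x) (f y)) >= / L * t - L).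

(** [compression_exponent_le X Y a] : alpha_Y(X) <= a  (for a >= 0),
    i.e. every alpha in the set whose sup defines alpha_Y(X) is <= a. *)
Definition compression_exponent_le (X Y : Banach) (a : R) : Prop :=
  0 <= a /\
  forall (alpha : R) (f : X -> Y) (L : R), 0 < alpha -> 0 < L -> coarse_embedding f ->
    (forall x y, vnorm (vsub (f x) (f y)) >= / L * rpow (vnorm (vsub x y)) alpha - L) ->
    alpha <= a.

(* Main.v *)
Require Import Defs.
From Stdlib Require Import Reals Lra Lia List Classical ClassicalEpsilon Cantor.
From mathcomp.classical Require classical_sets filter.
Import ListNotations.
Open Scope R_scope.
Set Bullet Behavior "Strict Subproofs".

(* Fix a nonprincipal ultrafilter U on nat.  Reflexivity of Y yields weak limits along U
   (the functional f |-> lim_U f(y_n) is a bidual element), and asymptotic q-smoothness gives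
   |x + y_n|^q <= |x|^q + B w^q for U-many n when y_n is weakly null along U and |y_n| <= w.
   If F is a Y-valued map on k-tuples that is w-Lipschitz in each coordinate, telescoping its
   iterated weak limits shows that greedily chosen k-tuples s satisfy |F(s) - u|^q <= k B w^q
   for a point u that depends on F only.  Apply this to F(s) = f(sum of x_n over s): if two
   such greedily chosen sums can be kept c k^a apart, a compression exponent alpha of f
   satisfies a alpha <= 1/q.

   Asymptotically l_1 sequences give a = 1.  In an infinite-dimensional X take a separated
   sequence y in the unit ball.  Either for some r < s and all k, U-many 2k-tuples carry a
   norm-one functional that is > s on the first k terms and < r on the last k, which again
   gives a = 1; or a diagonal argument extracts a weakly Cauchy subsequence, whose differences
   are weakly null and semi-normalized, and the co-Banach-Saks property gives a = 1/p. *)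

(** * Vector identities *)

Lemma vadd_cancel {X : Banach} (x y z : X) : vadd x y = vadd x z -> y = z.
Proof.
  intro H.
  rewrite <- (vadd_0 X y), <- (vadd_0 X z), <- (vadd_opp X x).
  now rewrite !vadd_assoc, (vadd_comm _ y x), (vadd_comm _ z x), H.
Qed.

Lemma vscal_0 {X : Banach} (x : X) : vscal 0 x = vzero.
Proof.
  apply (vadd_cancel (vscal 0 x)).
  rewrite <- vscal_distr_s, vadd_0. f_equal. ring.
Qed.

Lemma vscal_zero {X : Banach} a : vscal a (vzero : X) = vzero.
Proof. rewrite <- (vscal_0 (vzero : X)), vscal_assoc. f_equal. ring. Qed.

Lemma vopp_scal {X : Banach} (x : X) : vopp x = vscal (-1) x.
Proof.
  apply (vadd_cancel x). rewrite vadd_opp.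
  rewrite <- (vscal_1 X x) at 1. rewrite <- vscal_distr_s, <- (vscal_0 x).
  f_equal. ring.
Qed.

Inductive vexp :=
| VVar (n : nat) | VZero | VAdd (e f : vexp) | VOpp (e : vexp)
| VSub (e f : vexp) | VScal (a : R) (e : vexp).

Section Reflection.
Context {X : Banach}.

Fixpoint veval (env : list X) (e : vexp) : X :=
  match e with
  | VVar n => nth n env vzero
  | VZero => vzero
  | VAdd e f => vadd (veval env e) (veval env f)
  | VOpp e => vopp (veval env e)
  | VSub e f => vsub (veval env e) (veval env f)
  | VScal a e => vscal a (veval env e)
  end.

Fixpoint vcoef (e : vexp) (i : nat) : R :=
  match e with
  | VVar n => if Nat.eqb n i then 1 else 0
  | VZero => 0
  | VAdd e f => vcoef e i + vcoef f i
  | VOpp e => - vcoef e i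
  | VSub e f => vcoef e i - vcoef f i
  | VScal a e => a * vcoef e i
  end.

Fixpoint vlin (env : list X) (c : nat -> R) (i : nat) : X :=
  match env with
  | nil => vzero
  | x :: env => vadd (vscal (c i) x) (vlin env c (S i))
  end.

Lemma vadd_swap (x y z t : X) :
  vadd (vadd x y) (vadd z t) = vadd (vadd x z) (vadd y t).
Proof.
  rewrite !vadd_assoc. f_equal. rewrite <- !vadd_assoc. f_equal. apply vadd_comm.
Qed.

Lemma vlin_add env c d i :
  vlin env (fun j => c j + d j) i = vadd (vlin env c i) (vlin env d i).
Proof.
  revert i; induction env as [|x env IH]; intro i; simpl.
  - now rewrite vadd_0.
  - rewrite IH, vscal_distr_s. apply vadd_swap.
Qed.

Lemma vlin_scal env c a i :
  vlin env (fun j => a * c j) i = vscal a (vlin env c i).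
Proof.
  revert i; induction env as [|x env IH]; intro i; simpl.
  - now rewrite vscal_zero.
  - now rewrite IH, vscal_distr_v, vscal_assoc.
Qed.

Lemma vlin_ext env c d i :
  (forall j, (i <= j < i + length env)%nat -> c j = d j) -> vlin env c i = vlin env d i.
Proof.
  revert i; induction env as [|x env IH]; intros i H; simpl; trivial.
  rewrite H, (IH (S i)); trivial.
  - intros j Hj. apply H. simpl. lia.
  - simpl; lia.
Qed.

Lemma vlin_zero env i : vlin env (fun _ => 0) i = vzero.
Proof.
  revert i; induction env as [|x env IH]; intro i; simpl; trivial.
  now rewrite IH, vscal_0, vadd_0.
Qed.

Lemma vlin_var env n i :
  vlin env (fun j => if Nat.eqb (i + n) j then 1 else 0) i = nth n env vzero.
Proof.
  revert n i; induction env as [|x env IH]; intros n i; simpl; [now destruct n|].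
  destruct n as [|n].
  - rewrite Nat.add_0_r, Nat.eqb_refl, vscal_1.
    rewrite (vlin_ext env _ (fun _ => 0)), vlin_zero, vadd_0; trivial.
    intros j Hj. destruct (Nat.eqb_spec i j); trivial; lia.
  - replace (i + S n)%nat with (S i + n)%nat by lia. rewrite (IH n (S i)).
    destruct (Nat.eqb_spec (S i + n) i); [lia|].
    now rewrite vscal_0, vadd_comm, vadd_0.
Qed.

Lemma veval_vlin env e : veval env e = vlin env (vcoef e) 0.
Proof.
  induction e; simpl.
  - symmetry; apply (vlin_var env n 0).
  - symmetry; apply vlin_zero.
  - now rewrite vlin_add, IHe1, IHe2.
  - rewrite vopp_scal, IHe, <- vlin_scal. apply vlin_ext; intros; ring.
  - unfold vsub. rewrite vopp_scal, IHe1, IHe2, <- vlin_scal, <- vlin_add.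
    apply vlin_ext; intros; ring.
  - now rewrite vlin_scal, IHe.
Qed.

Fixpoint coef_agree (e f : vexp) (n : nat) : Prop :=
  match n with
  | O => True
  | S n => coef_agree e f n /\ vcoef e n = vcoef f n
  end.

Lemma veval_eq env e f : coef_agree e f (length env) -> veval env e = veval env f.
Proof.
  intro H. rewrite !veval_vlin. apply vlin_ext. simpl.
  induction (length env) as [|n IH]; intros j Hj; [lia|].
  destruct H as [H1 H2]. destruct (Nat.eq_dec j n) as [->|]; trivial.
  apply IH; trivial; lia.
Qed.

End Reflection.

Ltac vmem x l :=
  match l with
  | nil => constr:(false)
  | x :: _ => constr:(true)
  | _ :: ?l => vmem x l
  end.
Ltac vvars l t :=
  match t with
  | vzero => l
  | vadd ?a ?b => let l := vvars l a in vvars l b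
  | vsub ?a ?b => let l := vvars l a in vvars l b
  | vopp ?a => vvars l a
  | vscal _ ?a => vvars l a
  | _ => let b := vmem t l in
         match b with true => l | false => constr:(t :: l) end
  end.
Ltac vidx x l :=
  match l with
  | x :: _ => constr:(O)
  | _ :: ?l => let n := vidx x l in constr:(S n)
  end.
Ltac vreify l t :=
  match t with
  | vzero => constr:(VZero)
  | vadd ?a ?b => let a := vreify l a in let b := vreify l b in constr:(VAdd a b)
  | vsub ?a ?b => let a := vreify l a in let b := vreify l b in constr:(VSub a b)
  | vopp ?a => let a := vreify l a in constr:(VOpp a)
  | vscal ?r ?a => let a := vreify l a in constr:(VScal r a)
  | _ => let n := vidx t l in constr:(VVar n)
  end.
Ltac vreduce :=
  match goal with
  | |- @eq (car ?X) ?s ?t =>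
      let l := vvars (@nil (car X)) s in
      let l := vvars l t in
      let e := vreify l s in
      let f := vreify l t in
      change (veval l e = veval l f); apply veval_eq; simpl; repeat split
  end.
Ltac vring := vreduce; try ring.
Ltac vfield := vreduce; try field.

(** * Norms and functionals *)

Section Norm.
Context {X : Banach}.
Implicit Types x y z : X.

Lemma vnorm_0 : vnorm (vzero : X) = 0.
Proof. rewrite <- (vscal_0 vzero), vnorm_scal, Rabs_R0. ring. Qed.

Lemma vnorm_opp x : vnorm (vopp x) = vnorm x.
Proof. rewrite vopp_scal, vnorm_scal, Rabs_left by lra. ring. Qed.

Lemma vnorm_pos x : 0 <= vnorm x.
Proof.
  pose proof (vnorm_triangle X x (vopp x)) as H.
  rewrite vadd_opp, vnorm_0, vnorm_opp in H. lra.
Qed.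

Lemma vnorm_sub_sym x y : vnorm (vsub x y) = vnorm (vsub y x).
Proof. rewrite <- vnorm_opp. f_equal. vring. Qed.

Lemma vnorm_sub_triangle x y z : vnorm (vsub x z) <= vnorm (vsub x y) + vnorm (vsub y z).
Proof.
  replace (vsub x z) with (vadd (vsub x y) (vsub y z)) by vring. apply vnorm_triangle.
Qed.

Lemma vnorm_sub_le x y : vnorm (vsub x y) <= vnorm x + vnorm y.
Proof. rewrite <- (vnorm_opp y). apply vnorm_triangle. Qed.

Lemma vnorm_sub_ge x y : vnorm x - vnorm y <= vnorm (vsub x y).
Proof.
  pose proof (vnorm_triangle X (vsub x y) y) as H.
  replace (vadd (vsub x y) y) with x in H by vring. lra.
Qed.

Lemma vnorm_normalize x : x <> vzero -> vnorm (vscal (/ vnorm x) x) = 1.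
Proof.
  intro H. assert (0 < vnorm x).
  { destruct (vnorm_pos x) as [|E]; trivial. now elim H; apply vnorm_eq0. }
  rewrite vnorm_scal, Rabs_right.
  - field. lra.
  - left. now apply Rinv_0_lt_compat.
Qed.

Variable f : X -> R.
Hypothesis Hf : is_dual f.

Lemma dual_add x y : f (vadd x y) = f x + f y.
Proof. apply Hf. Qed.

Lemma dual_scal a x : f (vscal a x) = a * f x.
Proof. apply Hf. Qed.

Lemma dual_0 : f vzero = 0.
Proof. rewrite <- (vscal_0 vzero), dual_scal. ring. Qed.

Lemma dual_sub x y : f (vsub x y) = f x - f y.
Proof. unfold vsub. rewrite vopp_scal, dual_add, dual_scal. ring. Qed.

Lemma dual_bounded : exists M, 0 < M /\ forall x, Rabs (f x) <= M * vnorm x.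
Proof.
  destruct Hf as (_ & _ & M & HM). exists (Rabs M + 1).
  pose proof (Rabs_pos M). split; [lra|]. intro x.
  apply Rle_trans with (1 := HM x). apply Rmult_le_compat_r; [apply vnorm_pos|].
  pose proof (Rle_abs M). lra.
Qed.

End Norm.

(** * The Hahn-Banach theorem *)

Section HahnBanach.
Context {X : Banach}.
Variable x0 : X.

(* A norm-one functional on a subspace is encoded by its graph; the empty graph
   is admitted so that the union of the empty chain is a graph. *)
Definition hb_graph (G : X * R -> Prop) : Prop :=
  (forall x y r s, G (x, r) -> G (y, s) -> G (vadd x y, r + s)) /\
  (forall a x r, G (x, r) -> G (vscal a x, a * r)) /\
  (forall x r, G (x, r) -> r <= vnorm x) /\
  (forall x r, G (x, r) -> G (x0, vnorm x0)).

Lemma hb_maximal : exists G, hb_graph G /\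
  forall H, (forall z, G z -> H z) -> hb_graph H -> forall z, H z -> G z.
Proof.
  destruct (@classical_sets.Zorn_bigcup (X * R) hb_graph) as (G & HG & Gmax).
  - intros F FP Ft. split; [|split; [|split]].
    + intros x y r s [A FA Ax] [B FB By]. destruct (Ft A B FA FB) as [AB|BA].
      * exists B; trivial. apply (FP B FB); trivial. now apply AB.
      * exists A; trivial. apply (FP A FA); trivial. now apply BA.
    + intros a x r [A FA Ax]. exists A; trivial. now apply (FP A FA).
    + intros x r [A FA Ax]. now apply (FP A FA).
    + intros x r [A FA Ax]. exists A; trivial. now apply (FP A FA) with (1 := Ax).
  - exists G; split; trivial. intros H GH PH. apply NNPP. intro nHG.
    now apply (Gmax H).
Qed.

Lemma hb_functional (G : X * R -> Prop) x r s : hb_graph G -> G (x, r) -> G (x, s) -> r = s.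
Proof.
  intros (Ga & Gs & Gn & _) H1 H2.
  assert (K : forall r s, G (x, r) -> G (x, s) -> r <= s).
  { intros u v Hu Hv.
    pose proof (Gn _ _ (Ga _ _ _ _ Hu (Gs (-1) _ _ Hv))) as H.
    replace (vadd x (vscal (-1) x)) with (vzero : X) in H by vring.
    rewrite vnorm_0 in H. lra. }
  apply Rle_antisym; auto.
Qed.

Lemma hb_extend (G : X * R -> Prop) y : hb_graph G -> G (x0, vnorm x0) ->
  exists H, hb_graph H /\ (forall z, G z -> H z) /\ exists r, H (y, r).
Proof.
  intros HG Gx0. pose proof HG as (Ga & Gs & Gn & _).
  assert (G0 : G (vzero, 0)).
  { pose proof (Gs 0 _ _ Gx0) as H. now rewrite vscal_0, Rmult_0_l in H. }
  (* any value between sup (r - |x - y|) and inf (|x + y| - r) will do *)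
  assert (Hc : exists c, (forall x r, G (x, r) -> r - vnorm (vsub x y) <= c) /\
                         (forall x r, G (x, r) -> c <= vnorm (vadd x y) - r)).
  { assert (Hle : forall x r z s, G (x, r) -> G (z, s) ->
        r - vnorm (vsub x y) <= vnorm (vadd z y) - s).
    { intros x r z s H1 H2. pose proof (Gn _ _ (Ga _ _ _ _ H1 H2)) as H.
      pose proof (vnorm_triangle X (vsub x y) (vadd z y)) as T.
      replace (vadd (vsub x y) (vadd z y)) with (vadd x z) in T by vring. lra. }
    destruct (completeness (fun t => exists x r, G (x, r) /\ t = r - vnorm (vsub x y)))
      as [c [Hub Hlub]].
    - exists (vnorm (vadd vzero y) - 0). intros t (x & r & H & ->). now apply Hle.
    - exists (0 - vnorm (vsub vzero y)). now exists vzero, 0.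
    - exists c. split.
      + intros x r H. apply Hub. now exists x, r.
      + intros x r H. apply Hlub. intros t (z & s & H' & ->). now apply Hle. }
  destruct Hc as (c & Hc1 & Hc2).
  exists (fun z => exists x r a, G (x, r) /\ fst z = vadd x (vscal a y) /\ snd z = r + a * c).
  split; [split; [|split; [|split]]|split].
  - intros u v r s (x & r' & a & H & E1 & E2) (x' & s' & b & H' & E1' & E2').
    simpl in *. subst. exists (vadd x x'), (r' + s'), (a + b).
    split; [auto|split; [vring|ring]].
  - intros b u r (x & r' & a & H & E1 & E2). simpl in *. subst.
    exists (vscal b x), (b * r'), (b * a). split; [auto|split; [vring|ring]].
  - intros u r (x & r' & a & H & E1 & E2). simpl in *. subst.
    destruct (Rtotal_order a 0) as [Ha|[->|Ha]].
    + assert (Hi : 0 < / - a) by (apply Rinv_0_lt_compat; lra).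
      pose proof (Hc1 _ _ (Gs (/ - a) _ _ H)) as K.
      apply Rmult_le_reg_l with (1 := Hi).
      replace (/ - a * vnorm (vadd x (vscal a y))) with
        (vnorm (vscal (/ - a) (vadd x (vscal a y)))).
      2: { rewrite vnorm_scal, Rabs_right; lra. }
      replace (vscal (/ - a) (vadd x (vscal a y))) with (vsub (vscal (/ - a) x) y)
        by (vfield; lra).
      replace (/ - a * (r' + a * c)) with (/ - a * r' - c) by (field; lra). lra.
    + replace (vadd x (vscal 0 y)) with x by vring. rewrite Rmult_0_l, Rplus_0_r. auto.
    + assert (Hi : 0 < / a) by (apply Rinv_0_lt_compat; lra).
      pose proof (Hc2 _ _ (Gs (/ a) _ _ H)) as K.
      apply Rmult_le_reg_l with (1 := Hi).
      replace (/ a * vnorm (vadd x (vscal a y))) with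
        (vnorm (vscal (/ a) (vadd x (vscal a y)))).
      2: { rewrite vnorm_scal, Rabs_right; lra. }
      replace (vscal (/ a) (vadd x (vscal a y))) with (vadd (vscal (/ a) x) y)
        by (vfield; lra).
      replace (/ a * (r' + a * c)) with (/ a * r' + c) by (field; lra). lra.
  - intros _ _ _. exists x0, (vnorm x0), 0.
    split; [trivial|split; [simpl; vring|simpl; ring]].
  - intros [x r] H. exists x, r, 0. split; [trivial|split; [simpl; vring|simpl; ring]].
  - exists c, vzero, 0, 1. split; [trivial|split; [simpl; vring|simpl; ring]].
Qed.

Lemma norming_functional : exists f : X -> R, is_dual f /\
  (forall x, Rabs (f x) <= vnorm x) /\ f x0 = vnorm x0.
Proof.
  destruct hb_maximal as (G & HG & Gmax).
  assert (Gx0 : G (x0, vnorm x0)).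
  { pose (H := fun z : X * R => G z \/ (~ (exists z, G z)) /\
       exists a, z = (vscal a x0, a * vnorm x0)).
    apply (Gmax H).
    - intros z Gz. now left.
    - destruct HG as (Ga & Gs & Gn & G0). unfold H. split; [|split; [|split]].
      + intros x y r s [H1|[H0 (a & H1)]] [H2|[H0' (b & H2)]].
        * left; auto.
        * elim H0'. now exists (x, r).
        * elim H0. now exists (y, s).
        * right. split; trivial. exists (a + b). injection H1 as -> ->. injection H2 as -> ->.
          f_equal; [vring|ring].
      + intros a x r [H1|[H0 (b & H1)]]; [left; auto|right; split; trivial].
        exists (a * b). injection H1 as -> ->. f_equal; [vring|ring].
      + intros x r [H1|[H0 (b & H1)]]; [auto|]. injection H1 as -> ->.
        rewrite vnorm_scal. apply Rmult_le_compat_r; [apply vnorm_pos|apply Rle_abs].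
      + intros x r [H1|[H0 (b & H1)]]; [left; eauto|]. right. split; trivial.
        exists 1. f_equal; [vring|ring].
    - destruct (classic (exists z, G z)) as [[[x r] Gz]|H0].
      + left. now apply HG with (1 := Gz).
      + right. split; trivial. exists 1. f_equal; [vring|ring]. }
  assert (Gtot : forall x, exists r, G (x, r)).
  { intro x. destruct (hb_extend G x HG Gx0) as (H & HH & GH & r & Hr).
    exists r. now apply (Gmax H). }
  pose (f := fun x => epsilon (inhabits 0) (fun r => G (x, r))).
  assert (Hf : forall x, G (x, f x)) by (intro x; apply epsilon_spec, Gtot).
  assert (Hu : forall x r, G (x, r) -> f x = r).
  { intros x r H. apply (hb_functional G x); trivial. }
  pose proof HG as (Ga & Gs & Gn & _).
  assert (Hs : forall a x, f (vscal a x) = a * f x) by (intros; auto).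
  assert (Hb : forall x, Rabs (f x) <= vnorm x).
  { intro x. apply Rabs_le. split; [|auto].
    pose proof (Gn _ _ (Hf (vscal (-1) x))) as H.
    rewrite Hs, <- vopp_scal, vnorm_opp in H. lra. }
  exists f. split; [split; [|split]|split]; auto.
  exists 1. intro x. rewrite Rmult_1_l. auto.
Qed.

End HahnBanach.

(** * Limits along an ultrafilter *)

Record nonprincipal_ultrafilter (U : (nat -> Prop) -> Prop) : Prop := {
  ultra_and : forall P Q, U P -> U Q -> U (fun n => P n /\ Q n);
  ultra_mono : forall P Q : nat -> Prop, (forall n, P n -> Q n) -> U P -> U Q;
  ultra_or : forall P, U P \/ U (fun n => ~ P n);
  ultra_ex : forall P, U P -> exists n, P n;
  ultra_ge : forall N, U (fun n => (N <= n)%nat)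
}.

Lemma nonprincipal_ultrafilter_exists : exists U, nonprincipal_ultrafilter U.
Proof.
  pose (F := fun P : nat -> Prop => exists N, forall n, (N <= n)%nat -> P n).
  destruct (@filter.ultraFilterLemma nat F) as (U & HU & FU).
  - constructor.
    + intros (N & H). exact (H N (le_n N)).
    + constructor.
      * now exists O.
      * intros P Q (N & HP) (M & HQ). exists (N + M)%nat. intros n Hn.
        split; [apply HP|apply HQ]; lia.
      * intros P Q PQ (N & HP). exists N. intros n Hn. apply PQ, HP, Hn.
  - exists U. pose proof (@filter.ultra_proper _ _ HU) as HP.
    pose proof (@filter.filter_filter _ _ HP) as HF. constructor.
    + intros P Q. apply (@filter.filterI _ _ HF).
    + intros P Q. apply (@filter.filterS _ _ HF).
    + intro P. now apply filter.in_ultra_setVsetC.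
    + intros P UP. apply NNPP. intro nP. apply (@filter.filter_not_empty _ _ HP).
      apply (@filter.filterS _ _ HF P); trivial. intros n Pn. elim nP. now exists n.
    + intro N. apply FU. now exists N.
Qed.

Lemma Rabs_le_inv x a : Rabs x <= a -> - a <= x <= a.
Proof.
  intro H. pose proof (Rle_abs x). pose proof (Rle_abs (- x)) as H'.
  rewrite Rabs_Ropp in H'. lra.
Qed.

Section Ultralimits.
Variable U : (nat -> Prop) -> Prop.
Hypothesis HU : nonprincipal_ultrafilter U.

Lemma ultra_all (P : nat -> Prop) : (forall n, P n) -> U P.
Proof. intro H. apply (ultra_mono U HU) with (2 := ultra_ge U HU 0). auto. Qed.

Lemma ultra_forall_lt (P : nat -> nat -> Prop) B :
  (forall e, U (P e)) -> U (fun n => forall e, (e < B)%nat -> P e n).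
Proof.
  intro H. induction B as [|B IH].
  - apply ultra_all. intros; lia.
  - apply (ultra_mono U HU) with (2 := ultra_and U HU _ _ IH (H B)).
    intros n [H1 H2] e He. destruct (Nat.eq_dec e B) as [->|]; trivial. apply H1. lia.
Qed.

Lemma ultra_forall_lists (P : list nat -> nat -> Prop) B l :
  (forall t, U (P t)) ->
  U (fun n => forall t, length t = l -> Forall (fun e => (e < B)%nat) t -> P t n).
Proof.
  revert P. induction l as [|l IH]; intros P H.
  - apply (ultra_mono U HU) with (2 := H nil). intros n Hn [|e t]; [trivial|discriminate].
  - specialize (IH (fun t n => forall e, (e < B)%nat -> P (e :: t) n)).
    apply (ultra_mono U HU) with (2 := IH (fun t => ultra_forall_lt _ _ (fun e => H (e :: t)))).
    intros n Hn [|e t]; [discriminate|]. intros E Ht. inversion Ht; subst.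
    apply Hn; trivial. now injection E.
Qed.

Lemma ultra_cv_small a : Un_cv a 0 -> forall eps, 0 < eps -> U (fun n => Rabs (a n) < eps).
Proof.
  intros H eps He. destruct (H eps He) as (N & HN).
  apply (ultra_mono U HU) with (2 := ultra_ge U HU N).
  intros n Hn. specialize (HN n Hn). unfold Rdist in HN. now rewrite Rminus_0_r in HN.
Qed.

Definition is_ulim (a : nat -> R) (l : R) : Prop :=
  forall eps, 0 < eps -> U (fun n => Rabs (a n - l) < eps).

Lemma ulim_exists a M : (forall n, Rabs (a n) <= M) -> exists l, is_ulim a l.
Proof.
  intro HM.
  destruct (completeness (fun t => U (fun n => t <= a n))) as [l [Hub Hlub]].
  - exists M. intros t Ut. destruct (ultra_ex U HU _ Ut) as (n & Hn).
    specialize (HM n). apply Rabs_le_inv in HM. lra.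
  - exists (- M). apply ultra_all. intro n. specialize (HM n). apply Rabs_le_inv in HM. lra.
  - exists l. intros eps He.
    assert (H1 : U (fun n => l - eps < a n)).
    { apply NNPP. intro nU.
      enough (l <= l - eps) by lra. apply Hlub. intros t Ut. apply Rnot_lt_le. intro Ht.
      apply nU. apply (ultra_mono U HU) with (2 := Ut). intros; lra. }
    assert (H2 : U (fun n => a n < l + eps)).
    { destruct (ultra_or U HU (fun n => l + eps <= a n)) as [H|H].
      - specialize (Hub _ H). simpl in Hub. lra.
      - apply (ultra_mono U HU) with (2 := H). intros; lra. }
    apply (ultra_mono U HU) with (2 := ultra_and U HU _ _ H1 H2).
    intros n [? ?]. apply Rabs_def1; lra.
Qed.

Lemma ulim_le a l M : is_ulim a l -> U (fun n => a n <= M) -> l <= M.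
Proof.
  intros Hl HM. apply Rnot_lt_le. intro Hlt.
  destruct (ultra_ex U HU _ (ultra_and U HU _ _ HM (Hl (l - M) ltac:(lra)))) as (n & H1 & H2).
  apply Rabs_def2 in H2. lra.
Qed.

Lemma ulim_unique a l m : is_ulim a l -> is_ulim a m -> l = m.
Proof.
  assert (K : forall l m, is_ulim a l -> is_ulim a m -> l <= m).
  { intros u v Hu Hv. apply Rnot_lt_le. intro Hlt.
    destruct (ultra_ex U HU _ (ultra_and U HU _ _ (Hu ((u - v) / 2) ltac:(lra))
      (Hv ((u - v) / 2) ltac:(lra)))) as (n & H1 & H2).
    apply Rabs_def2 in H1. apply Rabs_def2 in H2. lra. }
  intros; apply Rle_antisym; auto.
Qed.

Lemma ulim_const c : is_ulim (fun _ => c) c.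
Proof. intros eps He. apply ultra_all. intros _. now rewrite Rminus_diag, Rabs_R0. Qed.

Lemma ulim_plus a b l m : is_ulim a l -> is_ulim b m -> is_ulim (fun n => a n + b n) (l + m).
Proof.
  intros Ha Hb eps He.
  apply (ultra_mono U HU) with (2 := ultra_and U HU _ _ (Ha (eps / 2) ltac:(lra))
      (Hb (eps / 2) ltac:(lra))).
  intros n [H1 H2]. apply Rabs_def2 in H1. apply Rabs_def2 in H2. apply Rabs_def1; lra.
Qed.

Lemma ulim_scal c a l : is_ulim a l -> is_ulim (fun n => c * a n) (c * l).
Proof.
  intros Ha eps He. pose proof (Rabs_pos c).
  assert (0 < / (Rabs c + 1)) by (apply Rinv_0_lt_compat; lra).
  apply (ultra_mono U HU) with (2 := Ha (eps * / (Rabs c + 1)) ltac:(nra)).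
  intros n Hn. replace (c * a n - c * l) with (c * (a n - l)) by ring.
  rewrite Rabs_mult. pose proof (Rabs_pos (a n - l)).
  apply Rle_lt_trans with ((Rabs c + 1) * Rabs (a n - l)); [nra|].
  replace eps with ((Rabs c + 1) * (eps * / (Rabs c + 1))) by (field; lra).
  apply Rmult_lt_compat_l; lra.
Qed.

Section WeakLimits.
Context {Y : Banach}.

Definition is_wlim (y : nat -> Y) (l : Y) : Prop :=
  forall f, is_dual f -> is_ulim (fun n => f (y n)) (f l).

Lemma wlim_const (l : Y) : is_wlim (fun _ => l) l.
Proof. intros f Hf. apply ulim_const. Qed.

Lemma wlim_sub y z (l m : Y) :
  is_wlim y l -> is_wlim z m -> is_wlim (fun n => vsub (y n) (z n)) (vsub l m).
Proof.
  intros Hy Hz f Hf eps He.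
  pose proof (ulim_plus _ _ _ _ (Hy f Hf) (ulim_scal (-1) _ _ (Hz f Hf)) eps He) as H.
  apply (ultra_mono U HU) with (2 := H). intros n Hn.
  rewrite !dual_sub by trivial.
  now replace (f (y n) - f (z n) - (f l - f m)) with
    (f (y n) + -1 * f (z n) - (f l + -1 * f m)) by ring.
Qed.

Lemma wlim_norm_le y (l : Y) M : is_wlim y l -> (forall n, vnorm (y n) <= M) -> vnorm l <= M.
Proof.
  intros Hl HM. destruct (norming_functional l) as (f & Hf & Hb & <-).
  apply (ulim_le _ _ _ (Hl f Hf)). apply ultra_all. intro n.
  apply Rle_trans with (2 := HM n). apply Rle_trans with (2 := Hb (y n)). apply Rle_abs.
Qed.

Lemma wlim_exists (y : nat -> Y) M : reflexive Y -> (forall n, vnorm (y n) <= M) ->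
  exists l, is_wlim y l.
Proof.
  intros HY HM. destruct (classic (exists x1 : Y, 0 < vnorm x1)) as [[x1 Hx1]|H0].
  2: { exists vzero. intros f Hf eps He. apply ultra_all. intro n.
       replace (y n) with (vzero : Y).
       - now rewrite Rminus_diag, Rabs_R0.
       - symmetry. apply vnorm_eq0. pose proof (vnorm_pos (y n)) as [H|H]; [|easy].
         elim H0. now exists (y n). }
  pose (Phi := fun f : Y -> R => epsilon (inhabits 0) (is_ulim (fun n => f (y n)))).
  assert (Hb : forall f K, (forall x, Rabs (f x) <= K * vnorm x) ->
            forall n, Rabs (f (y n)) <= Rabs K * M).
  { intros f K HK n. apply Rle_trans with (1 := HK (y n)).
    pose proof (vnorm_pos (y n)). pose proof (Rle_abs K). pose proof (Rabs_pos K).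
    specialize (HM n). nra. }
  assert (HPhi : forall f, is_dual f -> is_ulim (fun n => f (y n)) (Phi f)).
  { intros f (_ & _ & K & HK). apply epsilon_spec.
    exact (ulim_exists _ _ (Hb f K HK)). }
  assert (Hadd : forall f g, is_dual f -> is_dual g ->
            is_dual (fun x : Y => f x + g x)).
  { intros f g Hf Hg. split; [|split].
    - intros. rewrite !dual_add by trivial. ring.
    - intros. rewrite !dual_scal by trivial. ring.
    - destruct (dual_bounded f Hf) as (K & _ & HK). destruct (dual_bounded g Hg) as (L & _ & HL).
      exists (K + L). intro x. apply Rle_trans with (1 := Rabs_triang _ _).
      specialize (HK x). specialize (HL x). lra. }
  assert (Hscal : forall a f, is_dual f -> is_dual (fun x : Y => a * f x)).
  { intros a f Hf. split; [|split].
    - intros. rewrite !dual_add by trivial. ring.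
    - intros. rewrite !dual_scal by trivial. ring.
    - destruct (dual_bounded f Hf) as (K & _ & HK). exists (Rabs a * K). intro x.
      rewrite Rabs_mult, Rmult_assoc. apply Rmult_le_compat_l; [apply Rabs_pos|apply HK]. }
  destruct (HY Phi) as (l & Hl).
  - split; [|split].
    + intros f g Hf Hg. apply (ulim_unique (fun n => f (y n) + g (y n))).
      * apply (HPhi (fun x => f x + g x)); auto.
      * now apply ulim_plus; apply HPhi.
    + intros a f Hf. apply (ulim_unique (fun n => a * f (y n))).
      * apply (HPhi (fun x => a * f x)); auto.
      * now apply ulim_scal; apply HPhi.
    + exists M. intros f K Hf HK. rewrite Rmult_comm.
      assert (HK0 : forall n, Rabs (f (y n)) <= K * M).
      { assert (HK0 : 0 <= K).
        { specialize (HK x1). pose proof (Rabs_pos (f x1)). nra. }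
        intro n. rewrite <- (Rabs_pos_eq K) by trivial. now apply Hb. }
      apply Rabs_le. split.
      * enough (- Phi f <= K * M) by lra.
        replace (- Phi f) with (-1 * Phi f) by ring.
        apply (ulim_le _ _ _ (ulim_scal (-1) _ _ (HPhi f Hf))). apply ultra_all. intro n.
        specialize (HK0 n). apply Rabs_le_inv in HK0. lra.
      * apply (ulim_le _ _ _ (HPhi f Hf)). apply ultra_all. intro n.
        specialize (HK0 n). apply Rabs_le_inv in HK0. lra.
  - exists l. intros f Hf. rewrite <- Hl by trivial. now apply HPhi.
Qed.

End WeakLimits.
End Ultralimits.

(** * Subspaces of finite codimension *)

Lemma choice_fun {A B : Type} (P : A -> B -> Prop) :
  (forall x, exists y, P x y) -> exists f, forall x, P x (f x).
Proof.
  intro H. exists (fun x => proj1_sig (constructive_indefinite_description _ (H x))).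
  intro x. apply proj2_sig.
Qed.

Section Subspaces.
Context {Y : Banach}.
Implicit Types (E : Y -> Prop) (x y z : Y).

Lemma closed_subspace_sub E x y : closed_subspace E -> E x -> E y -> E (vsub x y).
Proof.
  intros (_ & Ea & Es & _) Hx Hy. unfold vsub. rewrite vopp_scal. auto.
Qed.

Lemma closed_subspace_dist E y : closed_subspace E -> ~ E y ->
  exists d, 0 < d /\ forall e, E e -> d <= vnorm (vsub y e).
Proof.
  intros (_ & _ & _ & Ec) Hy. apply NNPP. intro H.
  assert (Hn : forall n : nat, exists e, E e /\ vnorm (vsub y e) < / (INR n + 1)).
  { intro n. apply NNPP. intro Hn. apply H. exists (/ (INR n + 1)).
    pose proof (pos_INR n). split; [apply Rinv_0_lt_compat; lra|].
    intros e He. apply Rnot_lt_le. intro Hlt. apply Hn. now exists e. }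
  destruct (choice_fun _ Hn) as (u & Hu).
  apply Hy, (Ec u); [intro n; apply Hu|].
  intros eps He. destruct (archimed_cor1 eps He) as (N & HN & HN0).
  exists N. intros n Hle. rewrite vnorm_sub_sym.
  apply Rlt_le_trans with (1 := proj2 (Hu n)). apply Rle_trans with (/ INR N); [|lra].
  apply lt_INR in HN0. apply le_INR in Hle. simpl in HN0.
  apply Rinv_le_contravar; lra.
Qed.

Lemma line_coef_bound E y d : closed_subspace E ->
  (forall e, E e -> d <= vnorm (vsub y e)) ->
  forall e c, E e -> Rabs c * d <= vnorm (vadd e (vscal c y)).
Proof.
  intros HE Hd e c He. destruct (Req_dec c 0) as [->|Hc].
  - rewrite Rabs_R0, Rmult_0_l. apply vnorm_pos.
  - replace (vadd e (vscal c y)) with (vscal c (vsub y (vscal (- / c) e))) by now vfield.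
    rewrite vnorm_scal. apply Rmult_le_compat_l; [apply Rabs_pos|].
    apply Hd. now apply HE.
Qed.

Lemma closed_subspace_add_line E y : closed_subspace E ->
  closed_subspace (fun z => exists e c, E e /\ z = vadd e (vscal c y)).
Proof.
  intros HE. pose proof HE as (E0 & Ea & Es & Ec). split; [|split; [|split]].
  - exists vzero, 0. split; trivial. vring.
  - intros _ _ (e & c & He & ->) (e' & c' & He' & ->).
    exists (vadd e e'), (c + c'). split; auto. vring.
  - intros a _ (e & c & He & ->). exists (vscal a e), (a * c). split; auto. vring.
  - intros u l Hu Hl. destruct (classic (E y)) as [Hy|Hy].
    { exists l, 0. split; [|vring]. apply (Ec u); trivial.
      intro n. destruct (Hu n) as (e & c & He & ->). auto. }
    destruct (closed_subspace_dist E y HE Hy) as (d & Hd0 & Hd).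
    destruct (choice_fun _ Hu) as (e & He). destruct (choice_fun _ He) as (c & Hc).
    assert (Hcd : forall n m, Rabs (c n - c m) * d <= vnorm (vsub (u n) (u m))).
    { intros n m. destruct (Hc n) as [En ->], (Hc m) as [Em ->].
      replace (vsub (vadd (e n) (vscal (c n) y)) (vadd (e m) (vscal (c m) y)))
        with (vadd (vsub (e n) (e m)) (vscal (c n - c m) y)) by vring.
      apply (line_coef_bound E); trivial. now apply closed_subspace_sub. }
    destruct (R_complete c) as (cl & Hcl).
    { intros eps Heps. destruct (Hl (eps * d / 2)) as (N & HN); [nra|].
      exists N. intros n m Hn Hm. specialize (HN n Hn) as H1. specialize (HN m Hm) as H2.
      apply Rmult_lt_reg_r with (1 := Hd0). apply Rle_lt_trans with (1 := Hcd n m).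
      apply Rle_lt_trans with (1 := vnorm_sub_triangle _ l _).
      rewrite (vnorm_sub_sym l). lra. }
    exists (vsub l (vscal cl y)), cl. split; [|vring].
    apply (Ec e); [intro n; apply Hc|].
    intros eps Heps. pose proof (vnorm_pos y).
    destruct (Hl (eps / 2)) as (N & HN); [lra|].
    destruct (Hcl (eps / 2 / (vnorm y + 1))) as (M & HM); [apply Rdiv_lt_0_compat; lra|].
    exists (N + M)%nat. intros n Hn. specialize (HN n ltac:(lia)). specialize (HM n ltac:(lia)).
    replace (vsub (e n) (vsub l (vscal cl y))) with
      (vadd (vsub (u n) l) (vscal (cl - c n) y)).
    2: { destruct (Hc n) as [_ ->]. vring. }
    apply Rle_lt_trans with (1 := vnorm_triangle _ _ _). rewrite vnorm_scal.
    unfold Rdist in HM. rewrite Rabs_minus_sym in HM.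
    assert (Rabs (cl - c n) * vnorm y <= eps / 2); [|lra].
    replace (eps / 2) with (eps / 2 / (vnorm y + 1) * (vnorm y + 1)) by (field; lra).
    pose proof (Rabs_pos (cl - c n)). apply Rmult_le_compat; lra.
Qed.

Definition vcomb (phi : nat -> Y -> R) (ys : nat -> Y) (k : nat) (y : Y) : Y :=
  vsum (fun i => vscal (phi i y) (ys i)) k.

Lemma vsum_ext {X : Banach} (f g : nat -> X) k :
  (forall i, (i < k)%nat -> f i = g i) -> vsum f k = vsum g k.
Proof.
  induction k as [|k IH]; intro H; simpl; trivial. rewrite IH, H; auto.
Qed.

Section Comb.
Variables (phi : nat -> Y -> R) (ys : nat -> Y) (k : nat).
Hypothesis Hphi : forall i, (i < k)%nat -> is_dual (phi i).

Lemma vcomb_add x y : vcomb phi ys k (vadd x y) = vadd (vcomb phi ys k x) (vcomb phi ys k y).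
Proof.
  unfold vcomb. induction k as [|n IH]; simpl; [vring|].
  rewrite IH, dual_add by auto. vring.
Qed.

Lemma vcomb_scal a x : vcomb phi ys k (vscal a x) = vscal a (vcomb phi ys k x).
Proof.
  unfold vcomb. induction k as [|n IH]; simpl; [vring|].
  rewrite IH, dual_scal by auto. vring.
Qed.

Lemma vcomb_bounded : exists K, 0 <= K /\ forall x, vnorm (vcomb phi ys k x) <= K * vnorm x.
Proof.
  unfold vcomb. induction k as [|n IH]; simpl.
  - exists 0. split; [lra|]. intro. rewrite vnorm_0. lra.
  - destruct IH as (K & HK0 & HK); [auto|].
    destruct (dual_bounded (phi n)) as (M & HM0 & HM); [auto|].
    pose proof (vnorm_pos (ys n)). exists (K + M * vnorm (ys n)). split; [nra|].
    intro x. apply Rle_trans with (1 := vnorm_triangle _ _ _). rewrite vnorm_scal.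
    specialize (HK x). specialize (HM x). nra.
Qed.

Lemma vcomb_wlim_small U (y : nat -> Y) : nonprincipal_ultrafilter U -> is_wlim U y vzero ->
  forall d, 0 < d -> U (fun n => vnorm (vcomb phi ys k (y n)) < d).
Proof.
  intros HU Hy. unfold vcomb. induction k as [|j IH]; intros d Hd; simpl.
  - apply ultra_all; trivial. intro. now rewrite vnorm_0.
  - assert (IHj := IH ltac:(auto) (d / 2) ltac:(lra)).
    pose proof (vnorm_pos (ys j)).
    pose proof (Hy (phi j) ltac:(auto) (d / 2 / (vnorm (ys j) + 1))
                  ltac:(apply Rdiv_lt_0_compat; lra)) as Hj.
    apply (ultra_mono U HU) with (2 := ultra_and U HU _ _ IHj Hj).
    intros n [H1 H2]. rewrite dual_0, Rminus_0_r in H2 by auto.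
    apply Rle_lt_trans with (1 := vnorm_triangle _ _ _). rewrite vnorm_scal.
    assert (Rabs (phi j (y n)) * vnorm (ys j) <= d / 2); [|lra].
    replace (d / 2) with (d / 2 / (vnorm (ys j) + 1) * (vnorm (ys j) + 1)) by (field; lra).
    pose proof (Rabs_pos (phi j (y n))). apply Rmult_le_compat; lra.
Qed.

End Comb.

Lemma finite_codim_functionals k E ys : closed_subspace E ->
  (forall y, exists cs e, E e /\ y = vadd (vsum (fun i => vscal (cs i) (ys i)) k) e) ->
  exists phi, (forall i, (i < k)%nat -> is_dual (phi i)) /\
    forall y, E (vsub y (vcomb phi ys k y)).
Proof.
  revert E. induction k as [|k IH]; intros E HE Hspan.
  - exists (fun _ _ => 0). split; [intros; lia|]. intro y.
    destruct (Hspan y) as (cs & e & He & ->). unfold vcomb. simpl.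
    now replace (vsub (vadd vzero e) vzero) with e by vring.
  - destruct (IH _ (closed_subspace_add_line E (ys k) HE)) as (phi & Hphi & HF).
    { intro y. destruct (Hspan y) as (cs & e & He & ->).
      exists cs, (vadd e (vscal (cs k) (ys k))). split; [now exists e, (cs k)|]. simpl. vring. }
    (* the coordinate along [ys k] of [y - vcomb phi ys k y] *)
    assert (Hc : exists c, is_dual c /\
              forall y, E (vsub (vsub y (vcomb phi ys k y)) (vscal (c y) (ys k)))).
    { destruct (choice_fun _ HF) as (e & He). destruct (choice_fun _ He) as (c0 & Hc0).
      destruct (classic (E (ys k))) as [Hk|Hk].
      { exists (fun _ => 0). split; [split; [|split]|].
        - intros; ring.
        - intros; ring.
        - exists 0. intro x. rewrite Rabs_R0. lra.
        - intro y. destruct (Hc0 y) as [H1 ->].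
          apply closed_subspace_sub; [trivial|apply HE; trivial|]; now apply HE. }
      destruct (closed_subspace_dist E (ys k) HE Hk) as (d & Hd0 & Hd).
      assert (Hc1 : forall y, E (vsub (vsub y (vcomb phi ys k y)) (vscal (c0 y) (ys k)))).
      { intro y. destruct (Hc0 y) as [H1 ->].
        now replace (vsub (vadd (e y) (vscal (c0 y) (ys k))) (vscal (c0 y) (ys k)))
          with (e y) by vring. }
      assert (Hu : forall c, E (vscal c (ys k)) -> c = 0).
      { intros c H. apply NNPP. intro Hn. apply Hk.
        replace (ys k) with (vscal (/ c) (vscal c (ys k))) by now vfield. now apply HE. }
      exists c0. split; [split; [|split]|trivial].
      - intros x y. apply Rminus_diag_uniq, Hu.
        replace (vscal (c0 (vadd x y) - (c0 x + c0 y)) (ys k)) with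
          (vsub (vadd (vsub (vsub x (vcomb phi ys k x)) (vscal (c0 x) (ys k)))
                      (vsub (vsub y (vcomb phi ys k y)) (vscal (c0 y) (ys k))))
                (vsub (vsub (vadd x y) (vcomb phi ys k (vadd x y)))
                      (vscal (c0 (vadd x y)) (ys k)))).
        + apply closed_subspace_sub; trivial. now apply HE.
        + rewrite vcomb_add by trivial. vring.
      - intros a x. apply Rminus_diag_uniq, Hu.
        replace (vscal (c0 (vscal a x) - a * c0 x) (ys k)) with
          (vsub (vscal a (vsub (vsub x (vcomb phi ys k x)) (vscal (c0 x) (ys k))))
                (vsub (vsub (vscal a x) (vcomb phi ys k (vscal a x)))
                      (vscal (c0 (vscal a x)) (ys k)))).
        + apply closed_subspace_sub; trivial. now apply HE.
        + rewrite vcomb_scal by trivial. vring.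
      - destruct (vcomb_bounded phi ys k Hphi) as (K & HK0 & HK).
        exists ((1 + K) / d). intro x. apply Rmult_le_reg_r with (1 := Hd0).
        destruct (Hc0 x) as [He0 Ex].
        apply Rle_trans with (1 := line_coef_bound E (ys k) d HE Hd (e x) (c0 x) He0).
        rewrite <- Ex. replace ((1 + K) / d * vnorm x * d) with (vnorm x + K * vnorm x)
          by (field; lra).
        apply Rle_trans with (1 := vnorm_sub_le _ _). specialize (HK x). lra. }
    destruct Hc as (c & Hcd & Hc).
    exists (fun i => if Nat.eqb i k then c else phi i). split.
    + intros i Hi. destruct (Nat.eqb_spec i k); trivial. apply Hphi. lia.
    + intro y. specialize (Hc y). unfold vcomb in *. simpl. rewrite Nat.eqb_refl.
      rewrite (vsum_ext _ (fun i => vscal (phi i y) (ys i))).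
      * match goal with |- E ?a => match type of Hc with E ?b =>
          replace a with b by vring end end. trivial.
      * intros i Hi. destruct (Nat.eqb_spec i k); trivial; lia.
Qed.

Lemma finite_codim_approx U E (y : nat -> Y) : nonprincipal_ultrafilter U -> finite_codim E ->
  is_wlim U y vzero ->
  forall d, 0 < d -> U (fun n => exists e, E e /\ vnorm (vsub (y n) e) < d).
Proof.
  intros HU (HE & k & ys & Hys) Hy d Hd.
  destruct (finite_codim_functionals k E ys HE Hys) as (phi & Hphi & HF).
  apply (ultra_mono U HU) with (2 := vcomb_wlim_small phi ys k Hphi U y HU Hy d Hd).
  intros n Hn. exists (vsub (y n) (vcomb phi ys k (y n))). split; trivial.
  replace (vsub (y n) (vsub (y n) (vcomb phi ys k (y n)))) with (vcomb phi ys k (y n)) by vring.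
  trivial.
Qed.

End Subspaces.

(** * Asymptotic smoothness along weakly null sequences *)

Lemma rpow_eq t a : 0 < t -> rpow t a = Rpower t a.
Proof. intro H. unfold rpow. destruct (Rle_dec t 0); trivial; lra. Qed.

Lemma rpow_nonneg t a : 0 <= rpow t a.
Proof. unfold rpow. destruct (Rle_dec t 0); [lra|]. left. apply exp_pos. Qed.

Lemma rpow_le s t a : 0 <= a -> s <= t -> rpow s a <= rpow t a.
Proof.
  intros Ha H. destruct (Rle_or_lt s 0) as [Hs|Hs].
  - unfold rpow at 1. destruct (Rle_dec s 0); [apply rpow_nonneg|lra].
  - rewrite !rpow_eq by lra. apply Rle_Rpower_l; lra.
Qed.

Lemma exp_monotone x y : x <= y -> exp x <= exp y.
Proof. intros [H| ->]; [left; now apply exp_increasing|lra]. Qed.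

Lemma Rpower_1_plus_le q s c : 0 < q -> 0 <= s <= 1 -> 0 <= c ->
  Rpower (1 + c * s) q <= 1 + q * c * exp (q * c) * s.
Proof.
  intros Hq Hs Hc. set (v := q * (c * s)).
  assert (Hqc : 0 <= q * c) by nra. assert (Hcs : 0 <= c * s) by nra.
  assert (Hv : 0 <= v <= q * c) by (unfold v; split; [|rewrite <- Rmult_assoc]; nra).
  apply Rle_trans with (exp v).
  - unfold Rpower. apply exp_monotone.
    apply Rmult_le_compat_l; [lra|]. rewrite <- (ln_exp (c * s)) at 2.
    destruct (exp_ineq1_le (c * s)) as [L|L]; [left; apply ln_increasing; lra|rewrite L; lra].
  - pose proof (exp_ineq1_le (- v)) as H. pose proof (exp_pos v) as Hp.
    assert (E : exp v * exp (- v) = 1) by (rewrite <- exp_plus, Rplus_opp_r; apply exp_0).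
    assert (exp v <= 1 + v * exp v) by nra.
    assert (exp v <= exp (q * c)) by (now apply exp_monotone).
    replace (q * c * exp (q * c) * s) with (v * exp (q * c)) by (unfold v; ring).
    nra.
Qed.

Lemma asymptotic_smoothness_weakly_null U (Y : Banach) q C w (y : nat -> Y) :
  nonprincipal_ultrafilter U -> 0 < q ->
  (forall t, 0 <= t <= 1 -> rho_bar_le Y t (C * rpow t q)) ->
  0 < w -> is_wlim U y vzero -> (forall n, vnorm (y n) <= w) ->
  forall x, U (fun n => rpow (vnorm (vadd x (y n))) q <= rpow (vnorm x) q +
    (Rpower 2 q + q * (Rabs C + 1) * exp (q * (Rabs C + 1))) * Rpower w q).
Proof.
  intros HU Hq Hrho Hw Hy Hyw x. set (c := Rabs C + 1).
  assert (Hc : 1 <= c) by (unfold c; pose proof (Rabs_pos C); lra).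
  assert (HK : 0 <= q * c * exp (q * c)) by (apply Rmult_le_pos; [nra|left; apply exp_pos]).
  assert (Hwq : 0 < Rpower w q) by apply exp_pos.
  assert (H2q : 0 < Rpower 2 q) by apply exp_pos.
  destruct (Rle_or_lt (vnorm x) w) as [Hxw|Hxw].
  - apply ultra_all; trivial. intro n.
    apply Rle_trans with (rpow (2 * w) q).
    + apply rpow_le; [lra|]. apply Rle_trans with (1 := vnorm_triangle _ _ _).
      specialize (Hyw n). lra.
    + rewrite rpow_eq, <- Rpower_mult_distr by lra. pose proof (rpow_nonneg (vnorm x) q). nra.
  - set (N := vnorm x) in *. set (t := w / N).
    assert (Ht0 : 0 < t) by (apply Rdiv_lt_0_compat; lra).
    assert (HNt : N * t = w) by (unfold t; field; lra).
    assert (Ht1 : t < 1) by nra.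
    set (T := Rpower t q). assert (HT0 : 0 < T) by apply exp_pos.
    assert (HT1 : T <= 1).
    { unfold T. replace 1 with (Rpower 1 q) by (unfold Rpower; rewrite ln_1, Rmult_0_r; apply exp_0).
      apply Rle_Rpower_l; lra. }
    set (x' := vscal (/ N) x).
    assert (Hx' : vnorm x' = 1).
    { apply vnorm_normalize. intro E. unfold N in Hxw. rewrite E, vnorm_0 in Hxw. lra. }
    destruct (Hrho t ltac:(lra) x' Hx' (T / 2) ltac:(lra)) as (E & HE & Hsm).
    rewrite rpow_eq in Hsm by trivial. fold T in Hsm.
    set (d := N * T / 4). assert (Hd : 0 < d) by (unfold d; nra).
    apply (ultra_mono U HU) with (2 := finite_codim_approx U E y HU HE Hy d Hd).
    intros n (e & He & Hye). specialize (Hyw n).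
    assert (Hew : vnorm e <= w + d).
    { pose proof (vnorm_sub_ge e (y n)) as H. rewrite vnorm_sub_sym in H. lra. }
    set (e' := vscal (w / (w + d)) e).
    assert (Hs0 : 0 < w / (w + d)) by (apply Rdiv_lt_0_compat; lra).
    assert (Hs1 : w / (w + d) * (w + d) = w) by (field; lra).
    assert (He' : E e') by now apply HE.
    assert (Hne' : vnorm e' <= w).
    { unfold e'. rewrite vnorm_scal, Rabs_right by lra. nra. }
    assert (Hee' : vnorm (vsub e e') <= d).
    { replace (vsub e e') with (vscal (d / (w + d)) e) by (unfold e'; vfield; lra).
      assert (0 < d / (w + d)) by (apply Rdiv_lt_0_compat; lra).
      assert (d / (w + d) * (w + d) = d) by (field; lra).
      rewrite vnorm_scal, Rabs_right by lra. nra. }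
    assert (HCT : C * T <= Rabs C * T) by (pose proof (Rle_abs C); nra).
    assert (Hxe : vnorm (vadd x e') <= N * (1 + Rabs C * T + T / 2)).
    { destruct (classic (e' = vzero)) as [->|Hn0].
      - replace (vadd x vzero) with x by vring. fold N. pose proof (Rabs_pos C).
        assert (0 <= Rabs C * T) by nra. nra.
      - set (l := vnorm e' / w).
        assert (Hpos : 0 < vnorm e').
        { destruct (vnorm_pos e') as [|E0]; trivial. now elim Hn0; apply vnorm_eq0. }
        assert (Hl0 : 0 < l) by (apply Rdiv_lt_0_compat; lra).
        assert (Hlw : l * w = vnorm e') by (unfold l; field; lra).
        assert (Hl1 : l <= 1) by nra.
        assert (Hh : E (vscal (/ vnorm e') e')) by now apply HE.
        specialize (Hsm _ Hh (vnorm_normalize e' Hn0)).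
        replace (vadd x e') with (vscal N (vadd (vscal (1 - l) x')
          (vscal l (vadd x' (vscal t (vscal (/ vnorm e') e')))))).
        2: { unfold x'. set (ne := vnorm e') in *.
             vreduce; unfold l, t; field; lra. }
        rewrite vnorm_scal, (Rabs_right N) by lra. apply Rmult_le_compat_l; [lra|].
        apply Rle_trans with (1 := vnorm_triangle _ _ _).
        rewrite !(vnorm_scal _ (1 - l)), !(vnorm_scal _ l), (Rabs_right (1 - l)), (Rabs_right l), Hx' by lra.
        assert (0 <= Rabs C * T) by (pose proof (Rabs_pos C); nra).
        assert (l * vnorm (vadd x' (vscal t (vscal (/ vnorm e') e'))) <= l * (1 + Rabs C * T + T / 2))
          by (apply Rmult_le_compat_l; lra).
        assert (l * (Rabs C * T + T / 2) <= 1 * (Rabs C * T + T / 2)) by (apply Rmult_le_compat_r; lra).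
        lra. }
    assert (Hxy : vnorm (vadd x (y n)) <= N * (1 + c * T)).
    { replace (vadd x (y n)) with (vadd (vadd x e') (vadd (vsub e e') (vsub (y n) e))) by vring.
      apply Rle_trans with (1 := vnorm_triangle _ _ _).
      apply Rle_trans with (N * (1 + Rabs C * T + T / 2) + (d + d)).
      - apply Rplus_le_compat; trivial. apply Rle_trans with (1 := vnorm_triangle _ _ _). lra.
      - unfold d, c. lra. }
    apply Rle_trans with (1 := rpow_le _ _ q ltac:(lra) Hxy).
    assert (HcT : 0 <= c * T) by nra.
    rewrite !rpow_eq by (fold N; nra). rewrite <- Rpower_mult_distr by lra.
    pose proof (Rpower_1_plus_le q T c Hq ltac:(lra) ltac:(lra)) as H1.
    assert (HNq : 0 < Rpower N q) by apply exp_pos.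
    assert (HNT : Rpower N q * T = Rpower w q).
    { unfold T. rewrite Rpower_mult_distr by lra. now rewrite HNt. }
    apply Rle_trans with (Rpower N q * (1 + q * c * exp (q * c) * T)).
    + apply Rmult_le_compat_l; lra.
    + replace (Rpower N q * (1 + q * c * exp (q * c) * T)) with
        (Rpower N q + q * c * exp (q * c) * (Rpower N q * T)) by ring.
      rewrite HNT. nra.
Qed.

(** * Concentration of Lipschitz maps on tuples *)

(* Tuples are lists whose head is the coordinate chosen last. *)
Fixpoint chain (Q : list nat -> nat -> Prop) (s : list nat) : Prop :=
  match s with nil => True | n :: s => Q s n /\ chain Q s end.

Definition coord_lipschitz {Y : Banach} (F : list nat -> Y) (w : R) : Prop :=
  forall s1 s2 n m, vnorm (vsub (F (s1 ++ n :: s2)) (F (s1 ++ m :: s2))) <= w.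

Section Concentration.
Variable U : (nat -> Prop) -> Prop.
Hypothesis HU : nonprincipal_ultrafilter U.
Context {Y : Banach}.
Hypothesis HY : reflexive Y.
Variables (F : list nat -> Y) (w : R).
Hypothesis HF : coord_lipschitz F w.

Fixpoint itlim (d : nat) (s : list nat) : Y :=
  match d with
  | O => F s
  | S d => epsilon (inhabits vzero) (is_wlim U (fun n => itlim d (n :: s)))
  end.

Lemma itlim_wlim_of_lipschitz d s : coord_lipschitz (itlim d) w ->
  is_wlim U (fun n => itlim d (n :: s)) (itlim (S d) s).
Proof.
  intro H. simpl. apply epsilon_spec.
  apply (wlim_exists U HU _ (w + vnorm (itlim d (0%nat :: s))) HY). intro n.
  pose proof (vnorm_sub_ge (itlim d (n :: s)) (itlim d (0%nat :: s))).
  pose proof (H nil s n 0%nat) as K. simpl in K. lra.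
Qed.

Lemma itlim_lipschitz d : coord_lipschitz (itlim d) w.
Proof.
  induction d as [|d IH]; [exact HF|]. intros s1 s2 n m.
  apply (wlim_norm_le U HU) with (1 := wlim_sub U HU _ _ _ _
    (itlim_wlim_of_lipschitz d (s1 ++ n :: s2) IH)
    (itlim_wlim_of_lipschitz d (s1 ++ m :: s2) IH)).
  intro l. apply (IH (l :: s1)).
Qed.

Lemma itlim_wlim d s : is_wlim U (fun n => itlim d (n :: s)) (itlim (S d) s).
Proof. apply itlim_wlim_of_lipschitz, itlim_lipschitz. Qed.

Lemma itlim_increment d s n : vnorm (vsub (itlim d (n :: s)) (itlim (S d) s)) <= w.
Proof.
  apply (wlim_norm_le U HU) with
    (1 := wlim_sub U HU _ _ _ _ (wlim_const U HU _) (itlim_wlim d s)).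
  intro m. apply (itlim_lipschitz d nil).
Qed.

Variables (q C : R).
Hypothesis Hq : 0 < q.
Hypothesis Hrho : forall t, 0 <= t <= 1 -> rho_bar_le Y t (C * rpow t q).
Hypothesis Hw : 0 < w.

Lemma concentration : exists B, 0 < B /\ forall k, exists u, forall Q, (forall t, U (Q t)) ->
  exists s, length s = k /\ chain Q s /\ rpow (vnorm (vsub (F s) u)) q <= INR k * B.
Proof.
  set (B := (Rpower 2 q + q * (Rabs C + 1) * exp (q * (Rabs C + 1))) * Rpower w q).
  exists B. split.
  { apply Rmult_lt_0_compat; [|apply exp_pos]. apply Rplus_lt_0_compat; [apply exp_pos|].
    pose proof (Rabs_pos C).
    repeat apply Rmult_lt_0_compat; [lra|lra|apply exp_pos]. }
  intro k. set (u := itlim k nil). exists u. intros Q HQ.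
  assert (H : forall j, (j <= k)%nat -> exists s, length s = j /\ chain Q s /\
            rpow (vnorm (vsub (itlim (k - j) s) u)) q <= INR j * B).
  { induction j as [|j IH]; intro Hj.
    - exists nil. split; [trivial|split; [exact I|]]. rewrite Nat.sub_0_r. fold u.
      replace (vsub u u) with (vzero : Y) by vring. rewrite vnorm_0. unfold rpow.
      destruct (Rle_dec 0 0); simpl; lra.
    - destruct IH as (s & Hs & Hc & Hle); [lia|].
      replace (k - j)%nat with (S (k - S j)) in Hle by lia. set (d := (k - S j)%nat) in *.
      assert (Hnull : is_wlim U (fun n => vsub (itlim d (n :: s)) (itlim (S d) s)) vzero).
      { replace (vzero : Y) with (vsub (itlim (S d) s) (itlim (S d) s)) by vring.
        apply wlim_sub; trivial; [apply itlim_wlim|now apply wlim_const]. }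
      pose proof (asymptotic_smoothness_weakly_null U Y q C w _ HU Hq Hrho Hw Hnull
        (itlim_increment d s) (vsub (itlim (S d) s) u)) as Hstep.
      destruct (ultra_ex U HU _ (ultra_and U HU _ _ Hstep (HQ s))) as (n & Hn & HQn).
      exists (n :: s). split; [simpl; lia|split; [now split|]].
      replace (vsub (itlim d (n :: s)) u) with
        (vadd (vsub (itlim (S d) s) u) (vsub (itlim d (n :: s)) (itlim (S d) s))) by vring.
      apply Rle_trans with (1 := Hn). fold B. rewrite S_INR. lra. }
  destruct (H k (le_n k)) as (s & Hs & Hc & Hle). rewrite Nat.sub_diag in Hle.
  now exists s.
Qed.

End Concentration.

(** * Compression exponents *)

Fixpoint lsum {X : Banach} (x : nat -> X) (s : list nat) : X :=
  match s with nil => vzero | n :: s => vadd (x n) (lsum x s) end.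

(* Two sums of [k] terms at distance at least [c * k ^ a] can be selected greedily along [U]. *)
Definition spread (U : (nat -> Prop) -> Prop) {X : Banach} (x : nat -> X) (c a : R) : Prop :=
  forall k, (1 <= k)%nat -> exists Q1, (forall t, U (Q1 t)) /\
    forall s, length s = k -> chain Q1 s -> exists Q2, (forall t, U (Q2 t)) /\
      forall s', length s' = k -> chain Q2 s' ->
        c * Rpower (INR k) a <= vnorm (vsub (lsum x s) (lsum x s')).

Lemma growth_exponent_le c L D a b : 0 < c -> 0 <= b ->
  (forall k, (1 <= k)%nat -> c * Rpower (INR k) a - L <= D * Rpower (INR k) b) -> a <= b.
Proof.
  intros Hc Hb H. apply Rnot_lt_le. intro Hlt.
  set (K := (Rabs D + Rabs L) / c + 1).
  assert (HK : 0 < K).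
  { pose proof (Rabs_pos D). pose proof (Rabs_pos L).
    assert (0 <= (Rabs D + Rabs L) / c) by (apply Rle_mult_inv_pos; lra). unfold K; lra. }
  destruct (INR_archimed 1 (Rpower K (/ (a - b)))) as (m & Hm); [lra|].
  set (k := S m). assert (Hk : Rpower K (/ (a - b)) < INR k) by (unfold k; rewrite S_INR; lra).
  assert (Hk1 : 1 <= INR k) by (unfold k; rewrite S_INR; pose proof (pos_INR m); lra).
  specialize (H k ltac:(unfold k; lia)).
  assert (HKg : K < Rpower (INR k) (a - b)).
  { replace K with (Rpower (Rpower K (/ (a - b))) (a - b)).
    - apply Rlt_Rpower_l; [lra|]. split; [apply exp_pos|trivial].
    - rewrite Rpower_mult, Rinv_l, Rpower_1; lra. }
  assert (Hkb : 1 <= Rpower (INR k) b).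
  { replace 1 with (Rpower (INR k) 0) by (apply Rpower_O; lra).
    apply Rle_Rpower; lra. }
  replace (Rpower (INR k) a) with (Rpower (INR k) (a - b) * Rpower (INR k) b) in H
    by (rewrite <- Rpower_plus; f_equal; ring).
  set (P := Rpower (INR k) b) in *. set (G := Rpower (INR k) (a - b)) in *.
  assert (HcK : c * K = Rabs D + Rabs L + c) by (unfold K; field; lra).
  assert (c * (K * P) <= c * (G * P)).
  { apply Rmult_le_compat_l; [lra|]. apply Rmult_le_compat_r; lra. }
  replace (c * (K * P)) with ((Rabs D + Rabs L + c) * P) in * by (rewrite <- HcK; ring).
  pose proof (Rle_abs D). pose proof (Rle_abs L). pose proof (Rabs_pos L). nra.
Qed.

Lemma lsum_replace {X : Banach} (x : nat -> X) s1 s2 n m :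
  vsub (lsum x (s1 ++ n :: s2)) (lsum x (s1 ++ m :: s2)) = vsub (x n) (x m).
Proof.
  induction s1 as [|l s1 IH]; simpl; [vring|]. rewrite <- IH. vring.
Qed.

Section Compression.
Variable U : (nat -> Prop) -> Prop.
Hypothesis HU : nonprincipal_ultrafilter U.
Variables (q : R) (X Y : Banach).
Hypothesis Hq : 0 < q.
Hypothesis HY : reflexive Y.
Hypothesis Hs : asymptotically_q_uniformly_smooth q Y.

Lemma spread_compression (x : nat -> X) b c a (f : X -> Y) alpha L :
  (forall n, vnorm (x n) <= b) -> 0 < c -> spread U x c a ->
  coarse_embedding f -> 0 < alpha -> 0 < L ->
  (forall x y, vnorm (vsub (f x) (f y)) >= / L * rpow (vnorm (vsub x y)) alpha - L) ->
  a * alpha <= / q.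
Proof.
  intros Hb Hc Hsp [Hup _] Ha HL Hlow. destruct Hs as (C & HC).
  destruct (Hup (b + b)) as (M & HM).
  destruct (concentration U HU HY (fun s => f (lsum x s)) (Rabs M + 1)) with (q := q) (C := C)
    as (B & HB & Hconc); trivial.
  { intros s1 s2 n m. pose proof (Rle_abs M).
    enough (vnorm (vsub (f (lsum x (s1 ++ n :: s2))) (f (lsum x (s1 ++ m :: s2)))) <= M) by lra.
    apply HM. rewrite lsum_replace. apply Rle_trans with (1 := vnorm_sub_le _ _).
    now apply Rplus_le_compat. }
  { pose proof (Rabs_pos M). lra. }
  assert (Hiq : 0 < / q) by now apply Rinv_0_lt_compat.
  assert (HiL : 0 < / L) by now apply Rinv_0_lt_compat.
  apply (growth_exponent_le (/ L * Rpower c alpha) L (2 * Rpower B (/ q))); [|lra|].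
  { apply Rmult_lt_0_compat; [trivial|apply exp_pos]. }
  intros k Hk. assert (Hk0 : 0 < INR k) by (apply lt_0_INR; lia).
  destruct (Hsp k Hk) as (Q1 & HQ1 & Hsp1). destruct (Hconc k) as (u & Hu).
  destruct (Hu Q1 HQ1) as (s & Hlen & Hch & Hsu).
  destruct (Hsp1 s Hlen Hch) as (Q2 & HQ2 & Hsp2).
  destruct (Hu Q2 HQ2) as (s' & Hlen' & Hch' & Hsu').
  specialize (Hsp2 s' Hlen' Hch').
  assert (Hroot : forall r, rpow r q <= INR k * B ->
            r <= Rpower B (/ q) * Rpower (INR k) (/ q)).
  { intros r Hr. rewrite Rpower_mult_distr, (Rmult_comm B) by trivial.
    destruct (Rle_or_lt r 0) as [Hr0|Hr0].
    - apply Rle_trans with (1 := Hr0). left; apply exp_pos.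
    - rewrite rpow_eq in Hr by trivial.
      replace r with (Rpower (Rpower r q) (/ q)) by (rewrite Rpower_mult, Rinv_r, Rpower_1; lra).
      apply Rle_Rpower_l; [lra|]. split; [apply exp_pos|trivial]. }
  apply Hroot in Hsu. apply Hroot in Hsu'. rewrite vnorm_sub_sym in Hsu'.
  pose proof (vnorm_sub_triangle (f (lsum x s)) u (f (lsum x s'))) as Ht.
  specialize (Hlow (lsum x s) (lsum x s')).
  assert (Hk1 : 0 < Rpower (INR k) a) by apply exp_pos.
  assert (Hp : Rpower c alpha * Rpower (INR k) (a * alpha) <=
            rpow (vnorm (vsub (lsum x s) (lsum x s'))) alpha).
  { rewrite <- Rpower_mult, Rpower_mult_distr by trivial.
    rewrite <- rpow_eq by (now apply Rmult_lt_0_compat).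
    apply rpow_le; lra. }
  apply Rmult_le_compat_l with (r := / L) in Hp; lra.
Qed.

Lemma spread_compression_exponent_le (x : nat -> X) b c a :
  (forall n, vnorm (x n) <= b) -> 0 < c -> 0 < a -> spread U x c a ->
  compression_exponent_le X Y (/ q / a).
Proof.
  intros Hb Hc Ha Hsp. assert (0 < / q) by now apply Rinv_0_lt_compat. split.
  - left. now apply Rdiv_lt_0_compat.
  - intros alpha f L Hal HL Hf Hlow.
    pose proof (spread_compression x b c a f alpha L Hb Hc Hsp Hf Hal HL Hlow).
    apply Rmult_le_reg_l with (1 := Ha). replace (a * (/ q / a)) with (/ q) by (field; lra).
    trivial.
Qed.

End Compression.

Lemma compression_exponent_lt_1 X Y e :
  compression_exponent_le X Y e -> e < 1 -> ~ coarse_lipschitz_embeds X Y.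
Proof.
  intros [_ H] He (f & L & HL & Hup & Hlow).
  assert (HiL : 0 < / L) by now apply Rinv_0_lt_compat.
  enough (1 <= e) by lra. apply (H 1 f L); [lra|trivial| |].
  - split.
    + intro t. exists (L * t + L). intros x y. apply Hup.
    + intro K. exists (L * (K + L)). intros t Ht x y Hxy.
      apply Rge_trans with (1 := Hlow t x y Hxy).
      enough (/ L * (L * (K + L)) <= / L * t).
      { replace (/ L * (L * (K + L))) with (K + L) in * by (field; lra). lra. }
      apply Rmult_le_compat_l; lra.
  - intros x y. pose proof (Hlow (vnorm (vsub x y)) x y ltac:(lra)) as K.
    replace (rpow (vnorm (vsub x y)) 1) with (vnorm (vsub x y)); trivial.
    unfold rpow. destruct (Rle_dec (vnorm (vsub x y)) 0).
    + pose proof (vnorm_pos (vsub x y)). lra.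
    + rewrite Rpower_1; lra.
Qed.

(** * Increasing tuples *)

Definition above (N : nat) (t : list nat) (n : nat) : Prop :=
  (N <= n)%nat /\ Forall (fun e => (e < n)%nat) t.

Lemma ultra_above U N t : nonprincipal_ultrafilter U -> U (above N t).
Proof.
  intro HU. apply (ultra_and U HU); [apply (ultra_ge U HU)|].
  induction t as [|e t IH].
  - now apply ultra_all.
  - apply (ultra_mono U HU) with (2 := ultra_and U HU _ _ IH (ultra_ge U HU (S e))).
    intros n [H1 H2]. now constructor.
Qed.

Lemma chain_app Q s s' : chain Q s -> chain (fun t => Q (t ++ s)) s' -> chain Q (s' ++ s).
Proof. intros Hs. induction s' as [|n s' IH]; simpl; [trivial|]. intros [? ?]; auto. Qed.

Lemma chain_above_ge N s : chain (above N) s -> Forall (fun e => (N <= e)%nat) s.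
Proof.
  induction s as [|n s IH]; simpl; constructor; [apply H|apply IH, H].
Qed.

Lemma chain_above_incr N s : chain (above N) s ->
  incr_upto (fun j => nth j (rev s) O) (length s).
Proof.
  induction s as [|n s IH]; intros H i Hi; [simpl in Hi; lia|].
  destruct H as [[H1 H2] H3]. simpl in Hi. simpl rev.
  rewrite app_nth1 by (rewrite length_rev; lia).
  destruct (Nat.eq_dec (S i) (length s)) as [E|E].
  - rewrite app_nth2, length_rev, E, Nat.sub_diag by (rewrite length_rev; lia). simpl.
    rewrite Forall_forall in H2. apply H2, in_rev, nth_In. rewrite length_rev. lia.
  - rewrite app_nth1 by (rewrite length_rev; lia). apply IH; [trivial|lia].
Qed.

Lemma chain_above_first N s : chain (above N) s -> s <> nil -> (N <= nth 0 (rev s) O)%nat.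
Proof.
  intros H Hs. apply chain_above_ge in H. rewrite Forall_forall in H.
  apply H, in_rev, nth_In. rewrite length_rev. destruct s; [easy|simpl; lia].
Qed.

Lemma lsum_vsum {X : Banach} (x : nat -> X) s :
  vsum (fun j => x (nth j (rev s) O)) (length s) = lsum x s.
Proof.
  induction s as [|n s IH]; simpl; trivial.
  rewrite app_nth2, length_rev, Nat.sub_diag by (rewrite length_rev; lia). simpl.
  rewrite <- IH, vadd_comm. f_equal. apply vsum_ext. intros j Hj.
  now rewrite app_nth1 by (rewrite length_rev; lia).
Qed.

Lemma lsum_sub_vsum {X : Banach} (x : nat -> X) s s' :
  vsum (fun j => vscal (if Nat.ltb j (length s) then 1 else -1) (x (nth j (rev (s' ++ s)) O)))
    (length (s' ++ s)) = vsub (lsum x s) (lsum x s').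
Proof.
  induction s' as [|n s' IH]; simpl.
  - rewrite <- lsum_vsum.
    rewrite (vsum_ext _ (fun j => x (nth j (rev s) O))); [vring|].
    intros j Hj. destruct (Nat.ltb_spec j (length s)); [vring|lia].
  - rewrite app_nth2, length_rev, Nat.sub_diag by (rewrite length_rev; lia). simpl.
    rewrite length_app at 2. destruct (Nat.ltb_spec (length s' + length s) (length s)); [lia|].
    rewrite (vsum_ext _ (fun j => vscal (if Nat.ltb j (length s) then 1 else -1)
                                    (x (nth j (rev (s' ++ s)) O)))).
    + rewrite IH. vring.
    + intros j Hj. now rewrite (app_nth1 (rev (s' ++ s))) by (rewrite length_rev; lia).
Qed.

Lemma rsum_const_1 f m : (forall j, f j = 1) -> rsum f m = INR m.
Proof.
  intro H. induction m as [|m IH]; [reflexivity|]. rewrite S_INR. simpl. now rewrite IH, H.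
Qed.

Lemma asymptotically_l1_spread U (X : Banach) : nonprincipal_ultrafilter U ->
  contains_asymptotically_l1 X ->
  exists (x : nat -> X) b c, (forall n, vnorm (x n) <= b) /\ 0 < c /\ spread U x c 1.
Proof.
  intros HU (x & L & HL & Hx). destruct (Hx 1%nat) as (k1 & Hk1).
  assert (HiL : 0 < / L) by now apply Rinv_0_lt_compat.
  exists (fun n => x (k1 + n)%nat), L, (/ L). split; [|split; [trivial|]].
  - intro n. destruct (Hk1 (fun _ => (k1 + n)%nat)) with (a := fun _ : nat => 1) as [_ H].
    + intros i Hi. lia.
    + lia.
    + simpl in H. rewrite Rabs_R1 in H.
      replace (vadd vzero (vscal 1 (x (k1 + n)%nat))) with (x (k1 + n)%nat) in H by vring. lra.
  - intros k Hk. destruct (Hx (k + k)%nat) as (N & HN).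
    exists (above N). split; [intro; now apply ultra_above|]. intros s Hs Hcs.
    exists (fun t => above N (t ++ s)). split; [intro; now apply ultra_above|].
    intros s' Hs' Hcs'. pose proof (chain_app _ _ _ Hcs Hcs') as Hc.
    assert (Hlen : length (s' ++ s) = (k + k)%nat) by (rewrite length_app; lia).
    rewrite <- lsum_sub_vsum, Hlen.
    destruct (HN (fun j => (k1 + nth j (rev (s' ++ s)) O)%nat)) with
      (a := fun j => if Nat.ltb j (length s) then 1 else -1) as [H _].
    + intros i Hi. rewrite <- Hlen in Hi. pose proof (chain_above_incr N _ Hc i Hi).
      simpl in *. lia.
    + assert (s' ++ s <> nil) by (intro E; rewrite E in Hlen; simpl in Hlen; lia).
      pose proof (chain_above_first N _ Hc ltac:(trivial)). lia.
    + rewrite rsum_const_1, plus_INR in H.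
      * rewrite Rpower_1 by (apply lt_0_INR; lia). pose proof (pos_INR k). nra.
      * intro j. destruct (Nat.ltb j (length s)); [apply Rabs_R1|].
        rewrite Rabs_left; lra.
Qed.

Lemma dual_lsum_bound {X : Banach} (g : X -> R) (x : nat -> X) e s : is_dual g ->
  chain (fun _ n => Rabs (g (x n)) < e) s -> Rabs (g (lsum x s)) <= INR (length s) * e.
Proof.
  intros Hg. induction s as [|n s IH]; intro H.
  - simpl. rewrite dual_0, Rabs_R0 by trivial. lra.
  - destruct H as [H1 H2]. specialize (IH H2). change (length (n :: s)) with (S (length s)).
    rewrite S_INR. simpl lsum. rewrite dual_add by trivial.
    apply Rle_trans with (1 := Rabs_triang _ _). lra.
Qed.

Lemma co_banach_saks_spread U p (X : Banach) (z : nat -> X) : nonprincipal_ultrafilter U ->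
  co_banach_saks p X -> semi_normalized z -> weakly_null z ->
  exists (x : nat -> X) b c, (forall n, vnorm (x n) <= b) /\ 0 < c /\ spread U x c (/ p).
Proof.
  intros HU HX Hz Hwn. destruct (HX z Hz Hwn) as (phi & Hphi & c & Hc & Hlow).
  destruct Hz as (a & b & Ha & Hab).
  assert (Hge : forall n, (n <= phi n)%nat).
  { induction n as [|n IH]; [lia|]. specialize (Hphi n). lia. }
  exists (fun n => z (phi n)), b, (c / 2). split; [intro; apply Hab|split; [lra|]].
  intros k Hk. assert (Hk0 : 0 < INR k) by (apply lt_0_INR; lia).
  exists (above k). split; [intro; now apply ultra_above|]. intros s Hs Hcs.
  set (v := lsum (fun n => z (phi n)) s).
  assert (Hv : c * Rpower (INR k) (/ p) <= vnorm v).
  { specialize (Hlow k (fun j => nth j (rev s) O)). rewrite <- Hs in Hlow at 1.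
    rewrite rpow_eq in Hlow by trivial. unfold v. rewrite <- lsum_vsum, Hs.
    apply Rge_le, Hlow; [now apply chain_above_incr with k|].
    apply chain_above_first; trivial. intros ->. simpl in Hs. lia. }
  assert (Hv0 : 0 < vnorm v).
  { apply Rlt_le_trans with (2 := Hv). apply Rmult_lt_0_compat; [trivial|apply exp_pos]. }
  destruct (norming_functional v) as (g & Hg & Hg1 & Hgv).
  exists (fun _ n => Rabs (g (z (phi n))) < vnorm v / (2 * INR k)). split.
  - intros _. apply (ultra_cv_small U HU (fun n => g (z (phi n)))).
    + intros eps He. destruct (Hwn g Hg eps He) as (N & HN). exists N. intros n Hn.
      apply HN. specialize (Hge n). lia.
    + apply Rdiv_lt_0_compat; lra.
  - intros s' Hs' Hcs'. apply dual_lsum_bound in Hcs'; trivial. rewrite Hs' in Hcs'.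
    replace (INR k * (vnorm v / (2 * INR k))) with (vnorm v / 2) in Hcs' by (field; lra).
    apply Rabs_le_inv in Hcs'. fold v. specialize (Hg1 (vsub v (lsum (fun n => z (phi n)) s'))).
    rewrite dual_sub in Hg1 by trivial. apply Rabs_le_inv in Hg1. lra.
Qed.

(** * Separated sequences *)

Section Separated.
Context {X : Banach}.

Lemma riesz_lemma (E : X -> Prop) z : closed_subspace E -> ~ E z ->
  exists v, vnorm v = 1 /\ forall e, E e -> 1 / 2 <= vnorm (vsub v e).
Proof.
  intros HE Hz. destruct (closed_subspace_dist E z HE Hz) as (d0 & Hd0 & Hd).
  destruct (completeness (fun t => exists e, E e /\ t = - vnorm (vsub z e))) as [m [Hub Hlub]].
  - exists 0. intros t (e & He & ->). pose proof (vnorm_pos (vsub z e)). lra.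
  - exists (- vnorm (vsub z vzero)), vzero. split; [apply HE|trivial].
  - assert (Hm : m <= - d0).
    { apply Hlub. intros t (e & He & ->). specialize (Hd e He). lra. }
    assert (He0 : exists e0, E e0 /\ vnorm (vsub z e0) < 2 * - m).
    { apply NNPP. intro H. enough (m <= 2 * m) by lra. apply Hlub.
      intros t (e & He & ->). apply Rnot_lt_le. intro Hlt. apply H. exists e. split; [trivial|lra]. }
    destruct He0 as (e0 & He0 & Hlt).
    set (N := vnorm (vsub z e0)) in *.
    assert (HN : 0 < N) by (specialize (Hd e0 He0); fold N in Hd; lra).
    assert (HiN : 0 < / N) by now apply Rinv_0_lt_compat.
    exists (vscal (/ N) (vsub z e0)). split.
    + rewrite vnorm_scal, Rabs_right by lra. fold N. field. lra.
    + intros e He. apply Rmult_le_reg_l with (1 := HN).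
      replace (vsub (vscal (/ N) (vsub z e0)) e) with
        (vscal (/ N) (vsub z (vadd e0 (vscal N e)))) by (vfield; lra).
      rewrite vnorm_scal, Rabs_right by lra. rewrite <- Rmult_assoc, Rinv_r, Rmult_1_l by lra.
      assert (K : - vnorm (vsub z (vadd e0 (vscal N e))) <= m).
      { apply Hub. exists (vadd e0 (vscal N e)). split; [|trivial].
        apply HE; [trivial|]. now apply HE. }
      lra.
Qed.

Fixpoint span (l : list X) : X -> Prop :=
  match l with
  | nil => fun z => z = vzero
  | y :: l => fun z => exists e c, span l e /\ z = vadd e (vscal c y)
  end.

Lemma span_closed l : closed_subspace (span l).
Proof.
  induction l as [|y l IH]; [|now apply closed_subspace_add_line].
  split; [|split; [|split]]; simpl.
  - trivial.
  - intros x y -> ->. vring.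
  - intros a x ->. vring.
  - intros u m Hu Hm. apply vnorm_eq0. apply NNPP. intro H.
    pose proof (vnorm_pos m). destruct (Hm (vnorm m) ltac:(lra)) as (N & HN).
    specialize (HN N (le_n N)). rewrite Hu, vnorm_sub_sym in HN.
    replace (vsub m vzero) with m in HN by vring. lra.
Qed.

Lemma span_in l y : In y l -> span l y.
Proof.
  induction l as [|z l IH]; [easy|]. intros [->|H].
  - exists vzero, 1. split; [apply span_closed|vring].
  - exists y, 0. split; [auto|vring].
Qed.

Lemma span_vsum l z : span l z ->
  exists cs, z = vsum (fun i => vscal (cs i) (nth i (rev l) vzero)) (length l).
Proof.
  revert z; induction l as [|y l IH]; intros z Hz.
  - exists (fun _ => 0). now rewrite Hz.
  - destruct Hz as (e & c & He & ->). destruct (IH e He) as (cs & ->).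
    exists (fun i => if Nat.eqb i (length l) then c else cs i). simpl.
    rewrite Nat.eqb_refl, app_nth2, length_rev, Nat.sub_diag by (rewrite length_rev; lia).
    simpl. f_equal. apply vsum_ext. intros i Hi.
    rewrite app_nth1 by (rewrite length_rev; lia).
    destruct (Nat.eqb_spec i (length l)); [lia|trivial].
Qed.

Lemma separated_sequence : infinite_dimensional X ->
  exists y : nat -> X, (forall n, vnorm (y n) = 1) /\
    forall m n, (m < n)%nat -> 1 / 2 <= vnorm (vsub (y m) (y n)).
Proof.
  intro Hinf.
  assert (Hnext : forall l, exists v, vnorm v = 1 /\
            forall e, span l e -> 1 / 2 <= vnorm (vsub v e)).
  { intro l. destruct (classic (exists z, ~ span l z)) as [(z & Hz)|H].
    - apply (riesz_lemma _ z); trivial. apply span_closed.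
    - elim Hinf. exists (length l), (fun i => nth i (rev l) vzero). intro x.
      apply span_vsum. apply NNPP. intro Hx. apply H. now exists x. }
  destruct (choice_fun _ Hnext) as (next & Hn).
  set (ls := fix ls n := match n with O => nil | S n => next (ls n) :: ls n end).
  exists (fun n => next (ls n)). split; [intro; apply Hn|].
  intros m n Hmn. rewrite vnorm_sub_sym. apply Hn, span_in.
  induction Hmn as [|n Hmn IH]; simpl; auto.
Qed.

End Separated.

(** * Weakly Cauchy subsequences *)

Section WeaklyCauchy.
Variable U : (nat -> Prop) -> Prop.
Hypothesis HU : nonprincipal_ultrafilter U.
Context {X : Banach}.
Variable y : nat -> X.

Definition unit_dual (f : X -> R) : Prop := is_dual f /\ forall x, Rabs (f x) <= vnorm x.

Definition oscillates (r s : R) (k : nat) (t : list nat) : Prop :=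
  exists f, unit_dual f /\ Forall (fun e => f (y e) < r) (firstn k t) /\
    Forall (fun e => s < f (y e)) (skipn k t).

Fixpoint utree (P : list nat -> Prop) (d : nat) (t : list nat) : Prop :=
  match d with
  | O => P t
  | S d => U (fun n => utree P d (n :: t))
  end.

Lemma lsum_gt f x s t : is_dual f -> Forall (fun e => s < f (x e)) t ->
  INR (length t) * s <= f (@lsum X x t).
Proof.
  intros Hf. induction t as [|e t IH]; intro H.
  - simpl. rewrite dual_0 by trivial. lra.
  - inversion H; subst. specialize (IH ltac:(trivial)).
    change (length (e :: t)) with (S (length t)). rewrite S_INR. simpl lsum.
    rewrite dual_add by trivial. lra.
Qed.

Lemma lsum_lt f x r t : is_dual f -> Forall (fun e => f (x e) < r) t ->
  f (@lsum X x t) <= INR (length t) * r.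
Proof.
  intros Hf. induction t as [|e t IH]; intro H.
  - simpl. rewrite dual_0 by trivial. lra.
  - inversion H; subst. specialize (IH ltac:(trivial)).
    change (length (e :: t)) with (S (length t)). rewrite S_INR. simpl lsum.
    rewrite dual_add by trivial. lra.
Qed.

Lemma oscillation_spread r s : (forall k, utree (oscillates r s k) (k + k) nil) ->
  spread U y (s - r) 1.
Proof.
  intros H k Hk. set (P := oscillates r s k).
  set (Q := fun t n => (length t < k + k)%nat -> utree P (k + k - length t) t ->
              utree P (k + k - S (length t)) (n :: t)).
  assert (HQ : forall t, U (Q t)).
  { intro t. unfold Q.
    destruct (classic ((length t < k + k)%nat /\ utree P (k + k - length t) t)) as [[H1 H2]|H1].
    - replace (k + k - length t)%nat with (S (k + k - S (length t))) in H2 by lia.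
      apply (ultra_mono U HU) with (2 := H2). auto.
    - apply ultra_all; trivial. intros n H2 H3. elim H1. auto. }
  assert (Hch : forall t, chain Q t -> (length t <= k + k)%nat -> utree P (k + k - length t) t).
  { induction t as [|n t IH]; intros Hc Hl.
    - rewrite Nat.sub_0_r. apply H.
    - destruct Hc as [Hc1 Hc2]. simpl in Hl. apply Hc1; [lia|]. apply IH; [trivial|lia]. }
  exists Q. split; trivial. intros t Ht Hct.
  exists (fun t' => Q (t' ++ t)). split; [auto|]. intros t' Ht' Hct'.
  assert (Hlen : length (t' ++ t) = (k + k)%nat) by (rewrite length_app; lia).
  pose proof (Hch _ (chain_app _ _ _ Hct Hct') ltac:(lia)) as HP.
  rewrite Hlen, Nat.sub_diag in HP. destruct HP as (f & [Hf Hf1] & Hlo & Hhi).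
  rewrite <- Ht', firstn_app, Nat.sub_diag, firstn_all, app_nil_r in Hlo.
  rewrite <- Ht', skipn_app, Nat.sub_diag, skipn_all in Hhi.
  apply lsum_lt in Hlo; trivial. apply lsum_gt in Hhi; trivial. simpl in Hhi.
  rewrite Ht' in Hlo. rewrite Ht in Hhi.
  rewrite Rpower_1 by (apply lt_0_INR; lia).
  specialize (Hf1 (vsub (lsum y t) (lsum y t'))). rewrite dual_sub in Hf1 by trivial.
  apply Rabs_le_inv in Hf1. lra.
Qed.

(* Enumerates the intervals [z / (b + 1), (z + 1) / (b + 1)] with integer [z]. *)
Definition gap_lo (j : nat) : R :=
  let (a, b) := of_nat j in let (c, d) := of_nat a in (INR c - INR d) / (INR b + 1).
Definition gap_hi (j : nat) : R :=
  let (a, b) := of_nat j in let (c, d) := of_nat a in (INR c - INR d + 1) / (INR b + 1).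

Lemma gap_lt j : gap_lo j < gap_hi j.
Proof.
  unfold gap_lo, gap_hi. destruct (of_nat j) as [a b]. destruct (of_nat a) as [c d].
  pose proof (pos_INR b). apply Rmult_lt_compat_r; [apply Rinv_0_lt_compat|]; lra.
Qed.

Lemma gap_dense u v : u < v -> exists j, u < gap_lo j /\ gap_hi j < v.
Proof.
  intro Huv. destruct (INR_archimed (v - u) 2) as (b & Hb); [lra|].
  set (B := INR b + 1). assert (HB : 0 < B) by (unfold B; pose proof (pos_INR b); lra).
  assert (HB2 : 2 < B * (v - u)) by (unfold B; lra).
  destruct (archimed (u * B)) as [Hz1 Hz2]. set (z := up (u * B)) in *.
  assert (Hcd : exists c d, IZR z = INR c - INR d).
  { exists (Z.to_nat z), (Z.to_nat (- z)). rewrite !INR_IZR_INZ, <- minus_IZR. f_equal. lia. }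
  destruct Hcd as (c & d & Ecd).
  exists (to_nat (to_nat (c, d), b)). unfold gap_lo, gap_hi. rewrite !cancel_of_to.
  rewrite <- Ecd. fold B. split; apply Rmult_lt_reg_r with (1 := HB); unfold Rdiv;
    rewrite ?Rmult_assoc, Rinv_l, Rmult_1_r by lra; lra.
Qed.

(* If every oscillation pattern fails along [U], the failures are inherited by all tuples of a
   diagonal subsequence, on which no functional can then oscillate. *)
Section Diagonal.
Variable K : nat -> nat.
Let P j := oscillates (gap_lo j) (gap_hi j) (K j).
Hypothesis HK : forall j, ~ utree (P j) (K j + K j) nil.

Lemma diagonal_subsequence : exists m : nat -> nat,
  (forall i, (m i < m (S i))%nat) /\
  forall j I, chain (above j) I -> (length I <= K j + K j)%nat ->
    ~ utree (P j) (K j + K j - length I) (map m I).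
Proof.
  pose (cond := fun i B n => (B <= n)%nat /\ forall j, (j < S i)%nat ->
    forall l, (l < K j + K j)%nat -> forall t, length t = l -> Forall (fun e => (e < B)%nat) t ->
    (l < K j + K j)%nat -> ~ utree (P j) (K j + K j - l) t ->
    ~ utree (P j) (K j + K j - S l) (n :: t)).
  assert (Hcond : forall iB, exists n, cond (fst iB) (snd iB) n).
  { intros [i B]. apply (ultra_ex U HU). apply (ultra_and U HU); [apply (ultra_ge U HU)|].
    apply (ultra_forall_lt U HU) with (P := fun j n => forall l, _). intro j.
    apply (ultra_forall_lt U HU) with (P := fun l n => forall t, _). intro l.
    apply (ultra_forall_lists U HU). intro t.
    destruct (classic ((l < K j + K j)%nat /\ ~ utree (P j) (K j + K j - l) t)) as [[H1 H2]|H1].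
    - replace (K j + K j - l)%nat with (S (K j + K j - S l)) in H2 by lia. simpl in H2.
      destruct (ultra_or U HU (fun n => utree (P j) (K j + K j - S l) (n :: t))) as [H|H].
      + now elim H2.
      + apply (ultra_mono U HU) with (2 := H). auto.
    - apply ultra_all; trivial. intros n H2 H3. elim H1. auto. }
  destruct (choice_fun _ Hcond) as (next & Hnext).
  set (m := fix m i := match i with O => next (O, O) | S i => next (S i, S (m i)) end).
  assert (Hm : forall i, cond i (match i with O => O | S i => S (m i) end) (m i)).
  { intros [|i]; [apply (Hnext (O, O))|apply (Hnext (S i, S (m i)))]. }
  assert (Hlt : forall i, (m i < m (S i))%nat) by (intro i; apply (Hm (S i))).
  assert (Hmono : forall i i', (i <= i')%nat -> (m i <= m i')%nat).
  { intros i i' H. induction H as [|i' H IH]; [lia|]. specialize (Hlt i'). lia. }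
  exists m. split; trivial. intros j I. induction I as [|i I IH]; intros Hc Hl.
  - simpl length. rewrite Nat.sub_0_r. apply HK.
  - destruct Hc as [[Hc1 Hc2] Hc3]. simpl length in *.
    refine (proj2 (Hm i) j _ (length I) _ (map m I) _ _ _ _);
      [lia|lia|apply length_map| |lia|apply IH; [trivial|lia]].
    apply Forall_map. apply Forall_impl with (2 := Hc2). intros e He.
    destruct i as [|i]; [lia|]. specialize (Hmono e i). lia.
Qed.

Lemma chain_above_extend j (A : nat -> Prop) I k :
  (forall N, exists i, (N <= i)%nat /\ A i) -> chain (above j) I ->
  exists I', length I' = k /\ Forall A I' /\ chain (above j) (I' ++ I).
Proof.
  intros HA HI. induction k as [|k (I' & H1 & H2 & H3)]; [now exists nil|].
  assert (HB : exists N, (j <= N)%nat /\ Forall (fun e => (e < N)%nat) (I' ++ I)).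
  { destruct (ultra_ex U HU _ (ultra_above U j (I' ++ I) HU)) as (N & HN). now exists N. }
  destruct HB as (N & HN & HB). destruct (HA N) as (i & Hi & Ai).
  exists (i :: I'). split; [simpl; lia|split; [now constructor|]].
  split; trivial. split; [lia|]. apply Forall_impl with (2 := HB). intros; simpl in *; lia.
Qed.

Lemma no_oscillation_converges m f M : unit_dual f -> (forall n, Rabs (f (y n)) <= M) ->
  (forall j I, chain (above j) I -> (length I <= K j + K j)%nat ->
    ~ utree (P j) (K j + K j - length I) (map m I)) ->
  exists l, Un_cv (fun i => f (y (m i))) l.
Proof.
  intros Hf HM Hm. set (a := fun i => f (y (m i))).
  assert (Hosc : forall u v, u < v -> (forall N, exists i, (N <= i)%nat /\ a i <= u) ->
            (forall N, exists i, (N <= i)%nat /\ v <= a i) -> False).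
  { intros u v Huv Hlo Hhi. destruct (gap_dense u v Huv) as (j & Hj1 & Hj2).
    destruct (chain_above_extend j (fun i => v <= a i) nil (K j) Hhi I) as (I1 & L1 & A1 & C1).
    rewrite app_nil_r in C1.
    destruct (chain_above_extend j (fun i => a i <= u) I1 (K j) Hlo C1) as (I2 & L2 & A2 & C2).
    assert (Hlen : length (I2 ++ I1) = (K j + K j)%nat) by (rewrite length_app; lia).
    apply (Hm j _ C2 ltac:(lia)). rewrite Hlen, Nat.sub_diag. exists f. split; trivial.
    assert (E : K j = length (map m I2)) by (rewrite length_map; lia).
    rewrite map_app, E, firstn_app, skipn_app, Nat.sub_diag, firstn_all, skipn_all, app_nil_r.
    simpl. split; apply Forall_map.
    - apply Forall_impl with (2 := A2). intros i Hi. unfold a in Hi. lra.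
    - apply Forall_impl with (2 := A1). intros i Hi. unfold a in Hi. lra. }
  destruct (ulim_exists U HU a M) as (l & Hl); [intro; apply HM|].
  assert (Hnear : forall eps, 0 < eps -> forall N, exists i, (N <= i)%nat /\ Rabs (a i - l) < eps).
  { intros eps He N. apply (ultra_ex U HU). apply (ultra_and U HU); [apply (ultra_ge U HU)|auto]. }
  exists l. intros eps He. apply NNPP. intro H.
  assert (Hfar : forall N, exists i, (N <= i)%nat /\ eps <= Rabs (a i - l)).
  { intro N. apply NNPP. intro HN. apply H. exists N. intros n Hn.
    apply Rnot_le_lt. intro Hle. apply HN. now exists n. }
  destruct (classic (forall N, exists i, (N <= i)%nat /\ l + eps <= a i)) as [Hup|Hup].
  - apply (Hosc (l + eps / 2) (l + eps)); [lra| |trivial]. intro N.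
    destruct (Hnear (eps / 2) ltac:(lra) N) as (i & Hi & Hai). exists i. split; trivial.
    apply Rabs_def2 in Hai. lra.
  - apply not_all_ex_not in Hup. destruct Hup as (N0 & HN0).
    apply (Hosc (l - eps) (l - eps / 2)); [lra| |].
    + intro N. destruct (Hfar (N + N0)%nat) as (i & Hi & Hai). exists i. split; [lia|].
      apply Rnot_lt_le. intro Hlt. apply HN0. exists i. split; [lia|].
      apply Rnot_lt_le. intro Hlt'. assert (Rabs (a i - l) < eps) by (apply Rabs_def1; lra). lra.
    + intro N. destruct (Hnear (eps / 2) ltac:(lra) N) as (i & Hi & Hai). exists i.
      split; trivial. apply Rabs_def2 in Hai. lra.
Qed.

End Diagonal.

Lemma weakly_null_differences m :
  (forall f, unit_dual f -> exists l, Un_cv (fun i => f (y (m i))) l) ->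
  weakly_null (fun i => vsub (y (m (2 * i)%nat)) (y (m (2 * i + 1)%nat))).
Proof.
  intros Hcv f Hf. destruct (dual_bounded f Hf) as (M & HM0 & HM).
  assert (HiM : 0 < / M) by now apply Rinv_0_lt_compat.
  destruct (Hcv (fun x => / M * f x)) as (l & Hl).
  { assert (Hb : forall x, Rabs (/ M * f x) <= vnorm x).
    { intro x. rewrite Rabs_mult, (Rabs_right (/ M)) by lra.
      apply Rmult_le_reg_l with (1 := HM0). rewrite <- Rmult_assoc, Rinv_r, Rmult_1_l by lra.
      apply HM. }
    split; trivial. split; [|split].
    - intros. rewrite dual_add by trivial. ring.
    - intros. rewrite dual_scal by trivial. ring.
    - exists 1. intro x. rewrite Rmult_1_l. apply Hb. }
  intros eps He. destruct (Hl (/ M * eps / 2)) as (N & HN); [nra|].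
  exists N. intros n Hn. unfold Rdist in *. rewrite Rminus_0_r, dual_sub by trivial.
  specialize (HN (2 * n)%nat ltac:(lia)) as H1. specialize (HN (2 * n + 1)%nat ltac:(lia)) as H2.
  apply Rmult_lt_reg_l with (1 := HiM). rewrite <- (Rabs_right (/ M)) at 1 by lra.
  rewrite <- Rabs_mult. apply Rabs_def2 in H1. apply Rabs_def2 in H2. apply Rabs_def1; lra.
Qed.

End WeaklyCauchy.

Lemma infinite_dimensional_spread U p (X : Banach) : nonprincipal_ultrafilter U ->
  infinite_dimensional X -> co_banach_saks p X ->
  exists (x : nat -> X) b c a, (forall n, vnorm (x n) <= b) /\ 0 < c /\ spread U x c a /\
    (a = 1 \/ a = / p).
Proof.
  intros HU Hinf HX. destruct (separated_sequence Hinf) as (y & Hy1 & Hy2).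
  destruct (classic (exists j, forall k,
    utree U (oscillates y (gap_lo j) (gap_hi j) k) (k + k) nil)) as [(j & Hj)|H].
  - exists y, 1, (gap_hi j - gap_lo j), 1. pose proof (gap_lt j).
    split; [intro; rewrite Hy1; lra|]. split; [lra|]. split; [|now left].
    now apply oscillation_spread.
  - assert (HK : forall j, exists k,
      ~ utree U (oscillates y (gap_lo j) (gap_hi j) k) (k + k) nil).
    { intro j. apply not_all_ex_not. intro Hj. apply H. now exists j. }
    destruct (choice_fun _ HK) as (K & HK').
    destruct (diagonal_subsequence U HU y K HK') as (m & Hm1 & Hm2).
    assert (Hmlt : forall i, (m (2 * i) < m (2 * i + 1))%nat).
    { intro i. rewrite Nat.add_1_r. apply Hm1. }
    destruct (co_banach_saks_spread U p X
      (fun i => vsub (y (m (2 * i)%nat)) (y (m (2 * i + 1)%nat)))) as (x & b & c & H1 & H2 & H3);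
      trivial.
    + exists (1 / 2), 2. split; [lra|]. intro n. split; [now apply Hy2|].
      apply Rle_trans with (1 := vnorm_sub_le _ _). rewrite !Hy1. lra.
    + apply weakly_null_differences. intros f Hf.
      apply (no_oscillation_converges U HU y K m f 1 Hf); trivial.
      intro n. rewrite <- (Hy1 n). apply Hf.
    + exists x, b, c, (/ p). auto.
Qed.

Theorem theorem4p3 :
  forall (p q : R), 1 < p -> p < q ->
  forall Y : Banach, reflexive Y -> asymptotically_q_uniformly_smooth q Y ->
    (forall X : Banach, contains_asymptotically_l1 X ->
       compression_exponent_le X Y (/ q) /\ ~ coarse_lipschitz_embeds X Y) /\
    (forall X : Banach, infinite_dimensional X -> co_banach_saks p X -> ~ contains_l1 X ->
       compression_exponent_le X Y (p / q) /\ ~ coarse_lipschitz_embeds X Y).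
Proof.
  intros p q Hp Hpq Y HY Hs.
  destruct nonprincipal_ultrafilter_exists as (U & HU).
  assert (Hiq : 0 < / q) by (apply Rinv_0_lt_compat; lra).
  assert (Hip : 0 < / p) by (apply Rinv_0_lt_compat; lra).
  assert (Hq : q * / q = 1) by (field; lra).
  split.
  - intros X HX. destruct (asymptotically_l1_spread U X HU HX) as (x & b & c & Hb & Hc & Hsp).
    assert (H : compression_exponent_le X Y (/ q)).
    { rewrite <- (Rdiv_1_r (/ q)).
      apply (spread_compression_exponent_le U HU q X Y ltac:(lra) HY Hs x b c); trivial; lra. }
    split; trivial. apply (compression_exponent_lt_1 _ _ _ H). nra.
  - intros X Hinf HX _.
    destruct (infinite_dimensional_spread U p X HU Hinf HX) as (x & b & c & a & Hb & Hc & Hsp & Ha).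
    assert (Ha0 : 0 < a) by (destruct Ha; lra).
    pose proof (spread_compression_exponent_le U HU q X Y ltac:(lra) HY Hs x b c a Hb Hc Ha0 Hsp)
      as [H0 H1].
    assert (Hle : / q / a <= p / q).
    { destruct Ha as [-> | ->].
      - rewrite Rdiv_1_r. unfold Rdiv. nra.
      - right. field. lra. }
    assert (H : compression_exponent_le X Y (p / q)).
    { split; [lra|]. intros. apply Rle_trans with (2 := Hle). eauto. }
    split; trivial. apply (compression_exponent_lt_1 _ _ _ H). unfold Rdiv. nra.
Qed.
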